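(* Let $H$ be a Hopf algebra. (i) There exist a functor $\mathfrak{A}^\dag:H/\mathbf{M}\times H/\mathbf{M}_{\mathrm{fd}}^{\mathrm{op}}\to\mathbf{A}$ and a natural transformation $\mathfrak{h}^\dag$, assigning to $(W,V)$ a family of $H$-comodule morphisms $\mathfrak{h}^\dag(W,V):W\to V\otimes\mathfrak{A}^\dag(W,V)$, such that for every family $\phi:W\to V\otimes U$ of $H$-comodule morphisms from $W$ to $V$ there is a unique algebra morphism $\hat\phi:\mathfrak{A}^\dag(W,V)\to U$ satisfying $\phi=(\mathrm{id}_V\otimes\hat\phi)\,\mathfrak{h}^\dag(W,V)$. (ii) There exist a functor $\mathfrak{A}^\dag:H/\mathbf{M}_{\mathrm{fg}}\times H/\mathbf{M}^{\mathrm{op}}\to\mathbf{proA}_{\mathrm{fg}}$ and a natural transformation $\mathfrak{h}^\dag$, assigning to $(W,V)$ a pro-family of $H$-comodule morphisms $\mathfrak{h}^\dag(W,V):W\to V\otimes\mathfrak{A}^\dag(W,V)$, such that for every pro-family $\phi:W\to V\otimes U$ of $H$-comodule morphisms from $W$ to $V$ there is a unique pro-morphism $\hat\phi:\mathfrak{A}^\dag(W,V)\to U$ satisfying $\phi=(\mathrm{id}_V\otimes\hat\phi)\,\mathfrak{h}^\dag(W,V)$. In both parts, naturality means that $(\mathrm{id}_V\otimes\mathfrak{A}^\dag(g,f))\,\mathfrak{h}^\dag(W,V)=(f\otimes\mathrm{id})\,\mathfrak{h}^\dag(W',V')\,g$ for all morphisms $g:W\to W'$, $f:V'\to V$ in the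 respective categories.
   Context: Fix a field $\mathbb{K}$; algebras and tensor products are over $\mathbb{K}$. $\mathbf{A}$ is the category of unital associative (not necessarily commutative) algebras with unit-preserving morphisms. For a category $\mathbf{C}$, $\mathbf{proC}$ is the category of pro-objects (inverse systems $\{C_i\}_{i\in\mathbf{I}}$ in $\mathbf{C}$ indexed by directed sets) with $\mathbf{proC}(C,D)=\varprojlim_j\varinjlim_i\mathbf{C}(C_i,D_j)$; objects of $\mathbf{C}$ are regarded as pro-objects over a one-element index set. $\mathbf{proA}_{\mathrm{fg}}$ is the category of pro-objects of the category $\mathbf{A}_{\mathrm{fg}}$ of finitely generated algebras. For pro-algebras $A=\{A_i\}_{i\in\mathbf{I}}$, $B=\{B_j\}_{j\in\mathbf{J}}$, $A\otimes B$ is the pro-algebra indexed by $\mathbf{I}\times\mathbf{J}$ with $(A\otimes B)_{(i,j)}=A_i\otimes B_j$ and the evident transition maps. Let $H$ have comultiplication $\Delta$ and counit $\epsilon$. An $H$-comodule is an algebra $V\in\mathbf{A}$ with a coaction, i.e. an algebra morphism $\rho:V\to V\otimes H$ satisfying $(\rho\otimes\mathrm{id}_H)\rho=(\mathrm{id}_V\otimes\Delta)\rho$ and $(\mathrm{id}_V\otimes\epsilon)\rho=\mathrm{id}_V$. $H/\mathbf{M}$ is the category of $H$-comodules, with algebra morphisms respecting coactions as morphisms; $H/\mathbf{M}_{\mathrm{fd}}$ and $H/\mathbf{M}_{\mathrm{fg}}$ are the full subcategories of those whose underlying algebra is finite dimensional, respectively finitely generated as an algebra. For $V,W\in H/\mathbf{M}$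 with coactions $\rho:V\to V\otimes H$, $\varrho:W\to W\otimes H$, a (pro-)family of $H$-comodule morphisms from $W$ to $V$ is a pair $(U,\phi)$ where $U$ is a (pro-)algebra and $\phi:W\to V\otimes U$ is a (pro-)algebra morphism satisfying $(\mathrm{id}_V\otimes F)(\rho\otimes\mathrm{id}_U)\phi=(\phi\otimes\mathrm{id}_H)\varrho$, where $F$ is the flip $H\otimes U\to U\otimes H$. *)

(* Defs.v *)
From HB Require Import structures.
From mathcomp Require Import all_boot all_algebra.
From mathcomp Require Import boolp.

Set Implicit Arguments.
Unset Strict Implicit.
Unset Printing Implicit Defensive.

Import GRing.Theory.
Local Open Scope ring_scope.
Local Open Scope quotient_scope.

(* MathComp's [algType K] excludes the zero algebra, which is an object of the *)
(* category of unital algebras (and may occur as a universal algebra), hence   *)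
(* this variant over possibly zero rings. It extends modules only: a structure *)
(* joining [pzRingType] and [lmodType K] cannot be inserted below [lalgType K].*)
HB.mixin Record Lmodule_isPzAlgebra (K : fieldType) A of GRing.Lmodule K A := {
  pzone : A;
  pzmul : A -> A -> A;
  pzmulA : associative pzmul;
  pzmul1l : left_id pzone pzmul;
  pzmul1r : right_id pzone pzmul;
  pzmulDl : left_distributive pzmul +%R;
  pzmulDr : right_distributive pzmul +%R;
  pzmulZl : forall (a : K) (x y : A), pzmul (a *: x) y = a *: pzmul x y;
  pzmulZr : forall (a : K) (x y : A), pzmul x (a *: y) = a *: pzmul x y;
}.

#[short(type="pzAlgType")]
HB.structure Definition PzAlgebra (K : fieldType) :=
  {A of GRing.Lmodule K A & Lmodule_isPzAlgebra K A}.

HB.instance Definition _ (K : fieldType) (A : pzAlgType K) :=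
  GRing.Zmodule_isPzRing.Build (PzAlgebra.sort A)
    pzmulA pzmul1l pzmul1r pzmulDl pzmulDr.

Lemma pzscalerAl (K : fieldType) (A : pzAlgType K) (a : K) (x y : A) :
  a *: (x * y) = (a *: x) * y.
Proof. by rewrite [RHS]pzmulZl. Qed.

Lemma pzscalerAr (K : fieldType) (A : pzAlgType K) (a : K) (x y : A) :
  a *: (x * y) = x * (a *: y).
Proof. by rewrite [RHS]pzmulZr. Qed.

Fact regular_mulZl (K : fieldType) (a : K) (x y : K^o) :
  (a *: x) * y = a *: (x * y).
Proof. exact/esym/mulrA. Qed.

Fact regular_mulZr (K : fieldType) (a : K) (x y : K^o) :
  x * (a *: y) = a *: (x * y).
Proof. exact: mulrCA. Qed.

HB.instance Definition _ (K : fieldType) :=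
  Lmodule_isPzAlgebra.Build K K^o (@mulrA K) (@mul1r K) (@mulr1 K) (@mulrDl K) (@mulrDr K)
    (@regular_mulZl K) (@regular_mulZr K).

Record algHom (K : fieldType) (A B : pzAlgType K) := AlgHom {
  algHom_fun :> A -> B;
  algHom_linear : forall (a : K) x y,
    algHom_fun (a *: x + y) = a *: algHom_fun x + algHom_fun y;
  algHom1 : algHom_fun 1 = 1;
  algHomM : forall x y, algHom_fun (x * y) = algHom_fun x * algHom_fun y
}.

HB.instance Definition _ (K : fieldType) (A B : pzAlgType K) (f : algHom A B) :=
  GRing.isLinear.Build K A B *:%R (algHom_fun f) (@algHom_linear K A B f).

HB.instance Definition _ (K : fieldType) (A B : pzAlgType K) (f : algHom A B) :=
  GRing.isMonoidMorphism.Build A B (algHom_fun f)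
    (conj (algHom1 f) (@algHomM K A B f)).

Lemma algHom_eq (K : fieldType) (A B : pzAlgType K) (f g : algHom A B) :
  f =1 g -> f = g.
Proof.
case: f g => [f f1 f2 f3] [g g1 g2 g3] /= /funext efg.
by subst g; rewrite (Prop_irrelevance g1 f1) (Prop_irrelevance g2 f2)
                    (Prop_irrelevance g3 f3).
Qed.

Definition algId (K : fieldType) (A : pzAlgType K) : algHom A A :=
  @AlgHom K A A id (fun _ _ _ => erefl) erefl (fun _ _ => erefl).

Section AlgComp.
Variables (K : fieldType) (A B C : pzAlgType K) (g : algHom B C) (f : algHom A B).

Fact algComp_linear (a : K) x y : (g \o f) (a *: x + y) = a *: (g \o f) x + (g \o f) y.
Proof. by rewrite /= !linearP. Qed.

Fact algComp1 : (g \o f) 1 = 1.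
Proof. by rewrite /= !rmorph1. Qed.

Fact algCompM x y : (g \o f) (x * y) = (g \o f) x * (g \o f) y.
Proof. by rewrite /= !rmorphM. Qed.

Definition algComp : algHom A C := AlgHom algComp_linear algComp1 algCompM.
End AlgComp.

(* A list [:: (v1, u1); ...; (vn, un)] stands for the formal sum of the       *)
(* v_i (x) u_i; V (x) U is the quotient of the formal sums by the smallest    *)
(* additive congruence making (v, u) |-> v (x) u bilinear.                    *)
Section TensorDef.
Variables (K : fieldType) (V U : lmodType K).

Inductive tens_eq : seq (V * U) -> seq (V * U) -> Prop :=
| tens_refl s : tens_eq s s
| tens_sym s t : tens_eq s t -> tens_eq t s
| tens_trans s t r : tens_eq s t -> tens_eq t r -> tens_eq s r
| tens_cat s s' t t' : tens_eq s s' -> tens_eq t t' -> tens_eq (s ++ t) (s' ++ t')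
| tens_comm s t : tens_eq (s ++ t) (t ++ s)
| tens_addl v v' u : tens_eq [:: (v + v', u)] [:: (v, u); (v', u)]
| tens_addr v u u' : tens_eq [:: (v, u + u')] [:: (v, u); (v, u')]
| tens_scale a v u : tens_eq [:: (a *: v, u)] [:: (v, a *: u)]
| tens_zero u : tens_eq [:: (0, u)] [::].

Definition tens_eqb (s t : seq (V * U)) : bool := `[< tens_eq s t >].

Fact tens_eqb_equiv : equiv_class_of tens_eqb.
Proof.
split.
- by move=> s; apply/asboolP; apply: tens_refl.
- by move=> s t; apply/asboolP/asboolP; apply: tens_sym.
- by move=> s t r /asboolP h /asboolP h'; apply/asboolP; apply: tens_trans h h'.
Qed.

Canonical tens_equiv := EquivRelPack tens_eqb_equiv.

Definition tens : Type := {eq_quot tens_eqb}.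

HB.instance Definition _ := Choice.on tens.

Definition tcls (s : seq (V * U)) : tens := \pi_({eq_quot tens_eqb}) s.
Definition trep (x : tens) : seq (V * U) := repr (x : {eq_quot tens_eqb}).

Lemma trepK x : tcls (trep x) = x. Proof. exact: reprK. Qed.

Lemma tclsP s t : tens_eq s t <-> tcls s = tcls t.
Proof.
split=> [h|h]; first by apply/eqmodP/asboolP.
by move/eqmodP/asboolP: h.
Qed.

Lemma tens_eq_rep s : tens_eq (trep (tcls s)) s.
Proof. by apply/tclsP; rewrite trepK. Qed.

Definition tens_mk (v : V) (u : U) : tens := tcls [:: (v, u)].

Definition tens_add x y := tcls (trep x ++ trep y).
Definition tens_scal (a : K) x := tcls [seq (a *: p.1, p.2) | p <- trep x].

Lemma tens_addE s t : tens_add (tcls s) (tcls t) = tcls (s ++ t).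
Proof. by apply/tclsP; apply: tens_cat; apply: tens_eq_rep. Qed.

Lemma tens_scale_eq a s t : tens_eq s t ->
  tens_eq [seq (a *: p.1, p.2) | p <- s] [seq (a *: p.1, p.2) | p <- t].
Proof.
elim=> {s t} [s|s t _|s t r _ h _|s s' t t' _ h _|s t|v v' u|v u u'|b v u|u] /=.
- exact: tens_refl.
- exact: tens_sym.
- exact: tens_trans h.
- by rewrite !map_cat; apply: tens_cat.
- by rewrite !map_cat; apply: tens_comm.
- by rewrite scalerDr; apply: tens_addl.
- exact: tens_addr.
- rewrite scalerA mulrC -scalerA; exact: tens_scale.
- rewrite scaler0; exact: tens_zero.
Qed.

Lemma tens_scalE a s : tens_scal a (tcls s) = tcls [seq (a *: p.1, p.2) | p <- s].
Proof. by apply/tclsP; apply: tens_scale_eq; apply: tens_eq_rep. Qed.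

Fact tens_addA : associative tens_add.
Proof.
by move=> x y z; rewrite -(trepK x) -(trepK y) -(trepK z) !tens_addE catA.
Qed.

Fact tens_addC : commutative tens_add.
Proof.
move=> x y; rewrite -(trepK x) -(trepK y) !tens_addE.
by apply/tclsP; apply: tens_comm.
Qed.

Fact tens_add0 : left_id (tcls [::]) tens_add.
Proof. by move=> x; rewrite -(trepK x) tens_addE. Qed.

Fact tens_addN : left_inverse (tcls [::]) (tens_scal (-1)) tens_add.
Proof.
move=> x; rewrite -(trepK x) tens_scalE tens_addE; elim: (trep x) => [|[v u] s IHs] //=.
rewrite -cat1s -[(v, u) :: s]cat1s -!tens_addE.
rewrite [X in tens_add _ X]tens_addA [tens_add (tcls (map _ _)) _]tens_addC.
rewrite -[X in tens_add _ X]tens_addA [X in tens_add _ (tens_add _ X)]tens_addE IHs.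
rewrite [X in tens_add _ X]tens_addC tens_add0 tens_addE /=; apply/tclsP.
apply: tens_trans (tens_sym (tens_addl _ _ _)) _.
by rewrite scaleN1r addNr; apply: tens_zero.
Qed.

HB.instance Definition _ := GRing.isZmodule.Build tens
  tens_addA tens_addC tens_add0 tens_addN.

Lemma tcls_cat s t : tcls (s ++ t) = tcls s + tcls t.
Proof. by rewrite [RHS]tens_addE. Qed.

Lemma tcls_sum s : tcls s = \sum_(p <- s) tens_mk p.1 p.2.
Proof.
elim: s => [|[v u] s IHs]; first by rewrite big_nil.
by rewrite big_cons -IHs -cat1s tcls_cat.
Qed.

Fact tens_scalA a b x : tens_scal a (tens_scal b x) = tens_scal (a * b) x.
Proof.
rewrite -(trepK x) !tens_scalE -map_comp; congr tcls.
by apply: eq_map => p /=; rewrite scalerA.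
Qed.

Fact tens_scal1 : left_id 1 tens_scal.
Proof.
move=> x; rewrite -[RHS](trepK x) -{1}(trepK x) tens_scalE; congr tcls.
by rewrite -[RHS]map_id; apply: eq_map => -[v u] /=; rewrite scale1r.
Qed.

Fact tens_scalDr : right_distributive tens_scal +%R.
Proof.
move=> a x y; rewrite -(trepK x) -(trepK y) -tcls_cat !tens_scalE.
by rewrite map_cat tcls_cat.
Qed.

Fact tens_scalDl x : {morph tens_scal^~ x : a b / a + b}.
Proof.
move=> a b; rewrite -(trepK x) !tens_scalE; elim: (trep x) => [|[v u] s IHs] /=.
  by rewrite addr0.
rewrite -cat1s -[(a *: v, u) :: _]cat1s -[(b *: v, u) :: _]cat1s !tcls_cat IHs.
rewrite addrACA; congr (_ + _); rewrite -tcls_cat; apply/tclsP.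
by rewrite scalerDl; apply: tens_addl.
Qed.

HB.instance Definition _ := GRing.Zmodule_isLmodule.Build K tens
  tens_scalA tens_scal1 tens_scalDr tens_scalDl.

Lemma tens_mkDl v v' u : tens_mk (v + v') u = tens_mk v u + tens_mk v' u.
Proof. by rewrite -tcls_cat; apply/tclsP; apply: tens_addl. Qed.

Lemma tens_mkDr v u u' : tens_mk v (u + u') = tens_mk v u + tens_mk v u'.
Proof. by rewrite -tcls_cat; apply/tclsP; apply: tens_addr. Qed.

Lemma tens_mkZl a v u : tens_mk (a *: v) u = a *: tens_mk v u.
Proof. by rewrite [RHS]tens_scalE. Qed.

Lemma tens_mkZr a v u : tens_mk v (a *: u) = a *: tens_mk v u.
Proof. by rewrite -tens_mkZl; apply/esym/tclsP; apply: tens_scale. Qed.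

Lemma tens_ind (P : tens -> Prop) :
  P 0 -> (forall x y, P x -> P y -> P (x + y)) ->
  (forall v u, P (tens_mk v u)) -> forall x, P x.
Proof.
move=> P0 PD Pmk x; rewrite -(trepK x) tcls_sum.
by elim/big_ind: _ => // -[v u].
Qed.

End TensorDef.

Notation "v ⊗t u" := (tens_mk v u) (at level 35, no associativity).

Section TensorLift.
Variables (K : fieldType) (V U M : lmodType K).

Definition bilin (b : V -> U -> M) : Prop :=
  (forall u (a : K) v v', b (a *: v + v') u = a *: b v u + b v' u) /\
  (forall v (a : K) u u', b v (a *: u + u') = a *: b v u + b v u').

Definition tens_lift (b : V -> U -> M) (x : tens V U) : M :=
  \sum_(p <- trep x) b p.1 p.2.

Variables (b : V -> U -> M) (bP : bilin b).

Lemma bilin0l u : b 0 u = 0.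
Proof.
have := bP.1 u 1 0 0; rewrite !scale1r addr0 => /esym/eqP.
by rewrite -[X in _ == X]addr0 (inj_eq (addrI _)) => /eqP.
Qed.

Lemma bilin0r v : b v 0 = 0.
Proof.
have := bP.2 v 1 0 0; rewrite !scale1r addr0 => /esym/eqP.
by rewrite -[X in _ == X]addr0 (inj_eq (addrI _)) => /eqP.
Qed.

Lemma tens_lift_eq s t : tens_eq s t ->
  \sum_(p <- s) b p.1 p.2 = \sum_(p <- t) b p.1 p.2.
Proof.
elim=> {s t} [//|s t _ <-//|s t r _ -> _ ->//|s s' t t' _ h _ h'|s t|v v' u|v u u'|a v u|u].
- by rewrite !big_cat h h'.
- by rewrite !big_cat /= addrC.
- rewrite !big_cons !big_nil !addr0 /=.
  by have := bP.1 u 1 v v'; rewrite !scale1r.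
- rewrite !big_cons !big_nil !addr0 /=.
  by have := bP.2 v 1 u u'; rewrite !scale1r.
- rewrite !big_cons !big_nil !addr0 /=.
  have := bP.1 u a v 0; have := bP.2 v a u 0.
  by rewrite !addr0 bilin0l bilin0r !addr0 => -> ->.
- by rewrite big_cons big_nil /= bilin0l addr0.
Qed.

Lemma tens_lift_cls s : tens_lift b (tcls s) = \sum_(p <- s) b p.1 p.2.
Proof. by apply: tens_lift_eq; apply: tens_eq_rep. Qed.

Lemma tens_lift_mk v u : tens_lift b (v ⊗t u) = b v u.
Proof. by rewrite tens_lift_cls big_seq1. Qed.

Lemma tens_lift_linear a x y :
  tens_lift b (a *: x + y) = a *: tens_lift b x + tens_lift b y.
Proof.
rewrite -(trepK x) -(trepK y) [a *: _]tens_scalE -tcls_cat !tens_lift_cls.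
rewrite big_cat big_map /= scaler_sumr; congr (_ + _); apply: eq_bigr => p _.
by have := bP.1 p.2 a p.1 0; rewrite !addr0 bilin0l addr0.
Qed.

Lemma tens_lift0 : tens_lift b 0 = 0.
Proof. by rewrite [0](_ : _ = tcls [::]) // tens_lift_cls big_nil. Qed.

Lemma tens_liftD x y : tens_lift b (x + y) = tens_lift b x + tens_lift b y.
Proof. by rewrite -[x]scale1r tens_lift_linear !scale1r. Qed.

End TensorLift.

Lemma tens_ext (K : fieldType) (V U M : lmodType K) (f g : tens V U -> M) :
  (forall (a : K) x y, f (a *: x + y) = a *: f x + f y) ->
  (forall (a : K) x y, g (a *: x + y) = a *: g x + g y) ->
  (forall v u, f (v ⊗t u) = g (v ⊗t u)) -> f =1 g.
Proof.
move=> fL gL e.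
pose F := HB.pack_for {linear tens V U -> M} f
  (GRing.isLinear.Build K _ _ *:%R f fL).
pose G := HB.pack_for {linear tens V U -> M} g
  (GRing.isLinear.Build K _ _ *:%R g gL).
have f0 : f 0 = 0 := linear0 F.
have g0 : g 0 = 0 := linear0 G.
have fD : {morph f : x y / x + y} := linearD F.
have gD : {morph g : x y / x + y} := linearD G.
by elim/tens_ind => [|x y hx hy|//]; [rewrite f0 g0|rewrite fD gD hx hy].
Qed.

Section TensorMap.
Variables (K : fieldType) (V V' U U' : lmodType K).
Variables (f : {linear V -> V'}) (g : {linear U -> U'}).

Lemma tens_map_bilin : bilin (fun v u => f v ⊗t g u).
Proof.
by split=> [u a v v'|v a u u'];
  rewrite linearP ?tens_mkDl ?tens_mkDr ?tens_mkZl ?tens_mkZr.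
Qed.

Definition tens_map : tens V U -> tens V' U' :=
  tens_lift (fun v u => f v ⊗t g u).

Lemma tens_map_mk v u : tens_map (v ⊗t u) = f v ⊗t g u.
Proof. exact: (tens_lift_mk tens_map_bilin). Qed.

Fact tens_map_linear (a : K) x y :
  tens_map (a *: x + y) = a *: tens_map x + tens_map y.
Proof. exact: (tens_lift_linear tens_map_bilin). Qed.

HB.instance Definition _ := GRing.isLinear.Build K _ _ *:%R tens_map tens_map_linear.
End TensorMap.

Section TensorAlgebra.
Variables (K : fieldType) (A B : pzAlgType K).
Local Notation T := (tens A B).
Implicit Types x y z : T.

Lemma tens_mul_inner (a : A) (b : B) :
  bilin (fun (a' : A) (b' : B) => (a * a') ⊗t (b * b') : T).
Proof.
split=> [u c v v'|v c u u'].
  by rewrite mulrDr -pzscalerAr tens_mkDl tens_mkZl.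
by rewrite mulrDr -pzscalerAr tens_mkDr tens_mkZr.
Qed.

Lemma tens_mul_outer y :
  bilin (fun (a : A) (b : B) =>
    tens_lift (fun (a' : A) (b' : B) => (a * a') ⊗t (b * b') : T) y).
Proof.
have liftE a b s := tens_lift_cls (tens_mul_inner a b) s.
split=> [u c v v'|v c u u']; rewrite -(trepK y) !liftE scaler_sumr -big_split;
  apply: eq_bigr => p _ /=.
  by rewrite mulrDl -pzscalerAl tens_mkDl tens_mkZl.
by rewrite mulrDl -pzscalerAl tens_mkDr tens_mkZr.
Qed.

(* The product determined by (a (x) b) (a' (x) b') = a a' (x) b b'. *)
Definition tens_mul x y : T :=
  tens_lift (fun (a : A) (b : B) =>
    tens_lift (fun (a' : A) (b' : B) => (a * a') ⊗t (b * b')) y) x.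

Lemma tens_mul_mk a b a' b' :
  tens_mul (a ⊗t b) (a' ⊗t b') = (a * a') ⊗t (b * b').
Proof.
by rewrite /tens_mul (tens_lift_mk (tens_mul_outer _)) (tens_lift_mk (tens_mul_inner _ _)).
Qed.

Fact tens_mul_linl y (a : K) x x' :
  tens_mul (a *: x + x') y = a *: tens_mul x y + tens_mul x' y.
Proof. exact: (tens_lift_linear (tens_mul_outer y)). Qed.

Fact tens_mulDl : left_distributive tens_mul +%R.
Proof. by move=> x y z; have := tens_mul_linl z 1 x y; rewrite !scale1r. Qed.

Fact tens_mul0l y : tens_mul 0 y = 0.
Proof. exact: (tens_lift0 (tens_mul_outer y)). Qed.

Fact tens_mul_linr x (a : K) y y' :
  tens_mul x (a *: y + y') = a *: tens_mul x y + tens_mul x y'.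
Proof.
elim/tens_ind: x => [|x x' hx hx'|v u].
- by rewrite !tens_mul0l scaler0 addr0.
- by rewrite !tens_mulDl hx hx' scalerDr addrACA.
rewrite /tens_mul !(tens_lift_mk (tens_mul_outer _)).
exact: (tens_lift_linear (tens_mul_inner _ _)).
Qed.

Fact tens_mulDr : right_distributive tens_mul +%R.
Proof. by move=> x y z; have := tens_mul_linr x 1 y z; rewrite !scale1r. Qed.

Fact tens_mul0r x : tens_mul x 0 = 0.
Proof.
have := tens_mul_linr x 1 0 0; rewrite !scale1r addr0 => /esym/eqP.
by rewrite -[X in _ == X]addr0 (inj_eq (addrI _)) => /eqP.
Qed.

Fact tens_mulA : associative tens_mul.
Proof.
move=> x y z; elim/tens_ind: x => [|x x' hx hx'|a b].
- by rewrite !tens_mul0l.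
- by rewrite !tens_mulDl hx hx'.
elim/tens_ind: y => [|y y' hy hy'|a' b'].
- by rewrite tens_mul0l tens_mul0r tens_mul0l.
- by rewrite tens_mulDl !tens_mulDr tens_mulDl hy hy'.
elim/tens_ind: z => [|z z' hz hz'|a'' b''].
- by rewrite !tens_mul0r.
- by rewrite !tens_mulDr hz hz'.
by rewrite !tens_mul_mk !mulrA.
Qed.

Fact tens_mul1l : left_id ((1 : A) ⊗t (1 : B)) tens_mul.
Proof.
elim/tens_ind => [|x y hx hy|a b]; first by rewrite tens_mul0r.
  by rewrite tens_mulDr hx hy.
by rewrite tens_mul_mk !mul1r.
Qed.

Fact tens_mul1r : right_id ((1 : A) ⊗t (1 : B)) tens_mul.
Proof.
elim/tens_ind => [|x y hx hy|a b]; first by rewrite tens_mul0l.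
  by rewrite tens_mulDl hx hy.
by rewrite tens_mul_mk !mulr1.
Qed.

Fact tens_mulZl (a : K) x y : tens_mul (a *: x) y = a *: tens_mul x y.
Proof. by have := tens_mul_linl y a x 0; rewrite !addr0 tens_mul0l addr0. Qed.

Fact tens_mulZr (a : K) x y : tens_mul x (a *: y) = a *: tens_mul x y.
Proof. by have := tens_mul_linr x a y 0; rewrite !addr0 tens_mul0r addr0. Qed.

HB.instance Definition _ := Lmodule_isPzAlgebra.Build K T
  tens_mulA tens_mul1l tens_mul1r tens_mulDl tens_mulDr tens_mulZl tens_mulZr.

HB.instance Definition _ := GRing.PzRing.copy T (PzAlgebra.sort (T : pzAlgType K)).

Lemma tens_mkM (a a' : A) (b b' : B) :
  (a ⊗t b) * (a' ⊗t b') = (a * a') ⊗t (b * b') :> T.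
Proof. exact: tens_mul_mk. Qed.

Lemma tens_mk1 : (1 : A) ⊗t (1 : B) = 1 :> T.
Proof. by []. Qed.

Lemma tens_mult (C : pzAlgType K) (f : T -> C) :
  (forall (a : K) x y, f (a *: x + y) = a *: f x + f y) ->
  (forall a b a' b', f ((a ⊗t b) * (a' ⊗t b')) = f (a ⊗t b) * f (a' ⊗t b')) ->
  forall x y, f (x * y) = f x * f y.
Proof.
move=> fL e.
pose F := HB.pack_for {linear T -> C} f (GRing.isLinear.Build K _ _ *:%R f fL).
have f0 : f 0 = 0 := linear0 F.
have fD : {morph f : x y / x + y} := linearD F.
move=> x y; elim/tens_ind: x => [|x x' hx hx'|a b].
- by rewrite mul0r f0 mul0r.
- by rewrite mulrDl !fD mulrDl hx hx'.
elim/tens_ind: y => [|y y' hy hy'|a' b'].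
- by rewrite mulr0 f0 mulr0.
- by rewrite mulrDr !fD mulrDr hy hy'.
exact: e.
Qed.

End TensorAlgebra.

Section TensorAlgebraMap.
Variables (K : fieldType) (A A' B B' : pzAlgType K).
Variables (f : algHom A A') (g : algHom B B').

Fact tens_algMap1 : tens_map f g 1 = 1.
Proof. by rewrite -tens_mk1 tens_map_mk !rmorph1. Qed.

Fact tens_algMapM x y : tens_map f g (x * y) = tens_map f g x * tens_map f g y.
Proof.
apply: tens_mult => [a {}x {}y|a b a' b']; first exact: tens_map_linear.
by rewrite tens_mkM !tens_map_mk tens_mkM !rmorphM.
Qed.

Definition tens_algMap : algHom (tens A B) (tens A' B') :=
  AlgHom (@tens_map_linear K A A' B B' f g) tens_algMap1 tens_algMapM.
End TensorAlgebraMap.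

Section TensorAssoc.
Variables (K : fieldType) (A B C : pzAlgType K).

Lemma tens_assoc_inner (c : C) : bilin (fun (a : A) (b : B) => a ⊗t (b ⊗t c)).
Proof.
by split=> [u k v v'|v k u u'];
  rewrite ?tens_mkDl ?tens_mkZl ?tens_mkDr ?tens_mkZr.
Qed.

Lemma tens_assoc_outer :
  bilin (fun (x : tens A B) (c : C) => tens_lift (fun a b => a ⊗t (b ⊗t c)) x).
Proof.
split=> [c k x x'|x k c c']; first exact: (tens_lift_linear (tens_assoc_inner c)).
rewrite -(trepK x) !(tens_lift_cls (tens_assoc_inner _)) scaler_sumr -big_split.
by apply: eq_bigr => p _ /=; rewrite !tens_mkDr !tens_mkZr.
Qed.

Definition tens_assoc_fun : tens (tens A B) C -> tens A (tens B C) :=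
  tens_lift (fun x c => tens_lift (fun a b => a ⊗t (b ⊗t c)) x).

Lemma tens_assoc_mk a b c : tens_assoc_fun ((a ⊗t b) ⊗t c) = a ⊗t (b ⊗t c).
Proof.
by rewrite /tens_assoc_fun (tens_lift_mk tens_assoc_outer)
           (tens_lift_mk (tens_assoc_inner _)).
Qed.

Fact tens_assoc_linear (k : K) x y :
  tens_assoc_fun (k *: x + y) = k *: tens_assoc_fun x + tens_assoc_fun y.
Proof. exact: (tens_lift_linear tens_assoc_outer). Qed.

Fact tens_assoc1 : tens_assoc_fun 1 = 1.
Proof. by rewrite -!tens_mk1 tens_assoc_mk. Qed.

Fact tens_assocM x y :
  tens_assoc_fun (x * y) = tens_assoc_fun x * tens_assoc_fun y.
Proof.
apply: tens_mult => [a {}x {}y|x0 c x1 c']; first exact: tens_assoc_linear.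
pose F := HB.pack_for {linear tens (tens A B) C -> tens A (tens B C)} tens_assoc_fun
  (GRing.isLinear.Build K _ _ *:%R _ tens_assoc_linear).
have f0 : tens_assoc_fun 0 = 0 := linear0 F.
have fD : {morph tens_assoc_fun : x y / x + y} := linearD F.
have m0 z : (0 : tens A B) ⊗t (z : C) = 0.
  by rewrite -(scale0r (0 : tens A B)) tens_mkZl scale0r.
elim/tens_ind: x0 => [|x0 x0' h h'|a b].
- by rewrite m0 mul0r f0 mul0r.
- by rewrite tens_mkDl mulrDl !fD mulrDl h h'.
elim/tens_ind: x1 => [|x1 x1' h h'|a' b'].
- by rewrite m0 mulr0 f0 mulr0.
- by rewrite tens_mkDl mulrDr !fD mulrDr h h'.
by rewrite !tens_mkM !tens_assoc_mk !tens_mkM.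
Qed.

Definition tens_assoc : algHom (tens (tens A B) C) (tens A (tens B C)) :=
  AlgHom tens_assoc_linear tens_assoc1 tens_assocM.
End TensorAssoc.

Section TensorFlip.
Variables (K : fieldType) (A B : pzAlgType K).

Lemma tens_flip_bilin : bilin (fun (a : A) (b : B) => b ⊗t a).
Proof.
by split=> [u k v v'|v k u u'];
  rewrite ?tens_mkDl ?tens_mkZl ?tens_mkDr ?tens_mkZr.
Qed.

Definition tens_flip_fun : tens A B -> tens B A := tens_lift (fun a b => b ⊗t a).

Lemma tens_flip_mk a b : tens_flip_fun (a ⊗t b) = b ⊗t a.
Proof. exact: (tens_lift_mk tens_flip_bilin). Qed.

Fact tens_flip_linear (k : K) x y :
  tens_flip_fun (k *: x + y) = k *: tens_flip_fun x + tens_flip_fun y.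
Proof. exact: (tens_lift_linear tens_flip_bilin). Qed.

Fact tens_flip1 : tens_flip_fun 1 = 1.
Proof. by rewrite -!tens_mk1 tens_flip_mk. Qed.

Fact tens_flipM x y : tens_flip_fun (x * y) = tens_flip_fun x * tens_flip_fun y.
Proof.
apply: tens_mult => [a {}x {}y|a b a' b']; first exact: tens_flip_linear.
by rewrite tens_mkM !tens_flip_mk tens_mkM.
Qed.

Definition tens_flip : algHom (tens A B) (tens B A) :=
  AlgHom tens_flip_linear tens_flip1 tens_flipM.
End TensorFlip.

Lemma algHom_tens_eq (K : fieldType) (A B C : pzAlgType K)
    (f g : algHom (tens A B) C) : (forall a b, f (a ⊗t b) = g (a ⊗t b)) -> f = g.
Proof.
move=> e; apply: algHom_eq.
by apply: (tens_ext (algHom_linear f) (algHom_linear g)).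
Qed.

Lemma algHom_tens3_eq (K : fieldType) (A B C D : pzAlgType K)
    (f g : algHom (tens (tens A B) C) D) :
  (forall a b c, f ((a ⊗t b) ⊗t c) = g ((a ⊗t b) ⊗t c)) -> f = g.
Proof.
move=> e; apply: algHom_tens_eq => x c; move: x.
apply: (@tens_ext K A B D (fun x => f (x ⊗t c)) (fun x => g (x ⊗t c))) => // a x y;
  by rewrite tens_mkDl tens_mkZl algHom_linear.
Qed.

Lemma tens_assoc_map (K : fieldType) (A A' B B' C C' : pzAlgType K)
    (f : algHom A A') (g : algHom B B') (h : algHom C C') :
  algComp (tens_algMap f (tens_algMap g h)) (tens_assoc A B C) =
  algComp (tens_assoc A' B' C') (tens_algMap (tens_algMap f g) h).
Proof.
apply: algHom_tens3_eq => a b c /=.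
by rewrite tens_assoc_mk !tens_map_mk /= !tens_map_mk tens_assoc_mk.
Qed.

Lemma tens_flip_map (K : fieldType) (A A' B B' : pzAlgType K)
    (f : algHom A A') (g : algHom B B') :
  algComp (tens_algMap g f) (tens_flip A B) =
  algComp (tens_flip A' B') (tens_algMap f g).
Proof.
apply: algHom_tens_eq => a b /=.
by rewrite tens_flip_mk !tens_map_mk tens_flip_mk.
Qed.

(* The multiplication A (x) A -> A, linear but not an algebra morphism. *)
Definition mul_map (K : fieldType) (A : pzAlgType K) : tens A A -> A :=
  tens_lift (fun x y : A => x * y).

(* The canonical identifications A (x) K = A and K (x) A = A. *)
Definition tens_unitr (K : fieldType) (A : lmodType K) : tens A K^o -> A :=
  tens_lift (fun a (k : K^o) => (k : K) *: a).

Definition tens_unitl (K : fieldType) (A : lmodType K) : tens K^o A -> A :=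
  tens_lift (fun (k : K^o) a => (k : K) *: a).

Record hopfAlg (K : fieldType) := HopfAlg {
  hopf_alg :> pzAlgType K;
  comul : algHom hopf_alg (tens hopf_alg hopf_alg);
  counit : algHom hopf_alg K^o;
  antipode : {linear hopf_alg -> hopf_alg};
  hopf_coassoc : forall x,
    tens_assoc _ _ _ (tens_map comul (algId hopf_alg) (comul x)) =
    tens_map (algId hopf_alg) comul (comul x);
  hopf_counitl : forall x,
    tens_unitl (tens_map counit (algId hopf_alg) (comul x)) = x;
  hopf_counitr : forall x,
    tens_unitr (tens_map (algId hopf_alg) counit (comul x)) = x;
  hopf_antipodel : forall x,
    mul_map (tens_map antipode (algId hopf_alg) (comul x)) =
    (counit x : K) *: (1 : hopf_alg);
  hopf_antipoder : forall x,
    mul_map (tens_map (algId hopf_alg) antipode (comul x)) =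
    (counit x : K) *: (1 : hopf_alg)
}.

Record comodAlg (K : fieldType) (H : hopfAlg K) := ComodAlg {
  comod_alg :> pzAlgType K;
  coact : algHom comod_alg (tens comod_alg H);
  coact_coassoc : forall v,
    tens_assoc _ _ _ (tens_map coact (algId H) (coact v)) =
    tens_map (algId comod_alg) (comul H) (coact v);
  coact_counit : forall v,
    tens_unitr (tens_map (algId comod_alg) (counit H) (coact v)) = v
}.

Record comodHom (K : fieldType) (H : hopfAlg K) (V W : comodAlg H) := ComodHom {
  comodHom_alg :> algHom V W;
  comodHom_coact : forall v,
    coact W (comodHom_alg v) = tens_map comodHom_alg (algId H) (coact V v)
}.

Lemma comodHom_eq (K : fieldType) (H : hopfAlg K) (V W : comodAlg H)
  (f g : comodHom V W) : comodHom_alg f = comodHom_alg g -> f = g.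
Proof.
case: f g => [f hf] [g hg] /= e; subst g.
by rewrite (Prop_irrelevance hf hg).
Qed.

Lemma tens_map_id (K : fieldType) (A B : pzAlgType K) x :
  tens_map (algId A) (algId B) x = x.
Proof.
by apply: (tens_ext (g := id)) => [a {}x y||v u] //; rewrite ?tens_map_linear ?tens_map_mk.
Qed.

Lemma tens_map_comp (K : fieldType) (A A' A'' B B' B'' : pzAlgType K)
    (f : algHom A A') (f' : algHom A' A'') (g : algHom B B') (g' : algHom B' B'') x :
  tens_map (algComp f' f) (algComp g' g) x = tens_map f' g' (tens_map f g x).
Proof.
apply: (tens_ext (g := fun x => tens_map f' g' (tens_map f g x))) => [a {}x y|a {}x y|v u];
  by rewrite ?tens_map_linear ?tens_map_mk.
Qed.

Section ComodHomComp.
Variables (K : fieldType) (H : hopfAlg K).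

Fact comodId_coact (V : comodAlg H) v :
  coact V (algId V v) = tens_map (algId V) (algId H) (coact V v).
Proof. by rewrite tens_map_id. Qed.

Definition comodId (V : comodAlg H) : comodHom V V := ComodHom (@comodId_coact V).

Fact comodComp_coact (U V W : comodAlg H) (g : comodHom V W) (f : comodHom U V) v :
  coact W (algComp g f v) = tens_map (algComp g f) (algId H) (coact U v).
Proof.
rewrite /= !comodHom_coact -tens_map_comp.
by congr (tens_map _ _ _); apply: algHom_eq.
Qed.

Definition comodComp (U V W : comodAlg H) (g : comodHom V W) (f : comodHom U V) :
  comodHom U W := ComodHom (comodComp_coact g f).
End ComodHomComp.

Record category := Category {
  ob :> Type;
  mor : ob -> ob -> Type;
  idm : forall x, mor x x;
  compm : forall x y z, mor y z -> mor x y -> mor x z;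
  comp_idl : forall x y (f : mor x y), compm (idm y) f = f;
  comp_idr : forall x y (f : mor x y), compm f (idm x) = f;
  comp_assoc : forall x y z t (h : mor z t) (g : mor y z) (f : mor x y),
    compm h (compm g f) = compm (compm h g) f
}.

Arguments mor {c} x y.
Arguments idm {c} x.
Arguments compm {c x y z} g f.

Notation "g ∘ f" := (compm g f) (at level 40, left associativity).

Record functor (C D : category) := Functor {
  fob :> C -> D;
  fmap : forall x y, mor x y -> mor (fob x) (fob y);
  fmap_id : forall x, fmap (idm x) = idm (fob x);
  fmap_comp : forall x y z (g : mor y z) (f : mor x y),
    fmap (g ∘ f) = fmap g ∘ fmap f
}.

Arguments fmap {C D} _ {x y} _.

Definition Op (C : category) : category :=
  @Category C (fun x y => @mor C y x) (@idm C) (fun x y z g f => f ∘ g)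
    (fun x y f => comp_idr f) (fun x y f => comp_idl f)
    (fun x y z t h g f => esym (comp_assoc f g h)).

Definition FullSub (C : category) (P : C -> Prop) : category :=
  @Category {x : C | P x} (fun x y => mor (sval x) (sval y)) (fun x => idm (sval x))
    (fun x y z g f => g ∘ f)
    (fun x y f => comp_idl f) (fun x y f => comp_idr f)
    (fun x y z t h g f => comp_assoc h g f).

Definition Incl (C : category) (P : C -> Prop) : functor (FullSub P) C :=
  @Functor (FullSub P) C sval (fun x y f => f) (fun _ => erefl) (fun _ _ _ _ _ => erefl).

Section ProductCategory.
Variables C D : category.

Definition Prod_hom (x y : C * D) : Type := (mor x.1 y.1 * mor x.2 y.2)%type.

Fact Prod_idl (x y : C * D) (f : Prod_hom x y) :
  (idm y.1 ∘ f.1, idm y.2 ∘ f.2) = f.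
Proof. by case: f => f g; rewrite !comp_idl. Qed.

Fact Prod_idr (x y : C * D) (f : Prod_hom x y) :
  (f.1 ∘ idm x.1, f.2 ∘ idm x.2) = f.
Proof. by case: f => f g; rewrite !comp_idr. Qed.

Fact Prod_assoc (x y z t : C * D) (h : Prod_hom z t) (g : Prod_hom y z)
    (f : Prod_hom x y) :
  (h.1 ∘ (g.1 ∘ f.1), h.2 ∘ (g.2 ∘ f.2)) = ((h.1 ∘ g.1) ∘ f.1, (h.2 ∘ g.2) ∘ f.2).
Proof. by rewrite !comp_assoc. Qed.

Definition Prod : category :=
  @Category (C * D)%type Prod_hom (fun x => (idm x.1, idm x.2))
    (fun x y z g f => (g.1 ∘ f.1, g.2 ∘ f.2)) Prod_idl Prod_idr Prod_assoc.
End ProductCategory.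

(* Nonempty directed preorders; antisymmetry is not required. *)
Record dirset := Dirset {
  dir_sort :> Type;
  dir_le : dir_sort -> dir_sort -> Prop;
  dir_refl : forall i, dir_le i i;
  dir_trans : forall i j k, dir_le i j -> dir_le j k -> dir_le i k;
  dir_ub : forall i j, exists k, dir_le i k /\ dir_le j k;
  dir_inh : inhabited dir_sort
}.

Arguments dir_le {d} i j.

Definition dir_unit : dirset :=
  @Dirset unit (fun _ _ => True) (fun _ => I) (fun _ _ _ _ _ => I)
    (fun _ _ => ex_intro _ tt (conj I I)) (inhabits tt).

Section DirProd.
Variables I J : dirset.
Definition dir_prod_le (p q : I * J) := dir_le p.1 q.1 /\ dir_le p.2 q.2.

Fact dir_prod_refl p : dir_prod_le p p.
Proof. by split; apply: dir_refl. Qed.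

Fact dir_prod_trans p q r : dir_prod_le p q -> dir_prod_le q r -> dir_prod_le p r.
Proof. by case=> h1 h2 [h3 h4]; split; [apply: dir_trans h3|apply: dir_trans h4]. Qed.

Fact dir_prod_ub p q : exists r, dir_prod_le p r /\ dir_prod_le q r.
Proof.
have [i [h1 h2]] := dir_ub p.1 q.1; have [j [h3 h4]] := dir_ub p.2 q.2.
by exists (i, j).
Qed.

Fact dir_prod_inh : inhabited (I * J).
Proof. by have [i] := dir_inh I; have [j] := dir_inh J; split; exact: (i, j). Qed.

Definition dir_prod : dirset :=
  Dirset dir_prod_refl dir_prod_trans dir_prod_ub dir_prod_inh.
End DirProd.

Record proOb (C : category) := ProOb {
  pidx : dirset;
  pob :> pidx -> C;
  ptr : forall i j, dir_le i j -> mor (pob j) (pob i);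
  ptr_id : forall i (h : dir_le i i), ptr h = idm (pob i);
  ptr_comp : forall i j k (hij : dir_le i j) (hjk : dir_le j k) (hik : dir_le i k),
    ptr hij ∘ ptr hjk = ptr hik
}.

(* [colimHom X D] is the direct limit of the sets mor (X i) D. *)
Section ColimHom.
Variables (C : category) (X : proOb C).

Definition colim_rep (D : C) : Type := {i : pidx X & mor (X i) D}.

Definition colim_eq (D : C) (p q : colim_rep D) : Prop :=
  exists (k : pidx X) (hp : dir_le (projT1 p) k) (hq : dir_le (projT1 q) k),
    projT2 p ∘ ptr hp = projT2 q ∘ ptr hq.

Definition colim_eqb (D : C) (p q : {classic (colim_rep D)}) : bool :=
  `[< colim_eq p q >].

Fact colim_eqb_equiv (D : C) : equiv_class_of (@colim_eqb D).
Proof.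
split.
- by move=> [i f]; apply/asboolP; exists i, (dir_refl i), (dir_refl i).
- by move=> p q; apply/asboolP/asboolP => -[k [hp [hq e]]]; exists k, hq, hp.
move=> q p r /asboolP[k [hp [hq e]]] /asboolP[l [hq' [hr e']]].
have [m [hk hl]] := dir_ub k l; apply/asboolP.
exists m, (dir_trans hp hk), (dir_trans hr hl).
rewrite -(ptr_comp hp hk) -(ptr_comp hr hl) !comp_assoc e -e' -!comp_assoc.
by rewrite (ptr_comp hq hk (dir_trans hq hk)) (ptr_comp hq' hl (dir_trans hq hk)).
Qed.

Canonical colim_equiv (D : C) := EquivRelPack (colim_eqb_equiv D).

Definition colimHom (D : C) : Type := {eq_quot @colim_eqb D}.

Definition cin (D : C) (i : pidx X) (f : mor (X i) D) : colimHom D :=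
  \pi_({eq_quot @colim_eqb D}) (existT _ i f : {classic (colim_rep D)}).

Definition crep (D : C) (c : colimHom D) : colim_rep D :=
  repr (c : {eq_quot @colim_eqb D}).

Lemma crepK (D : C) (c : colimHom D) : cin (projT2 (crep c)) = c.
Proof.
rewrite /cin -[RHS](reprK (c : {eq_quot @colim_eqb D})); congr (\pi _).
by rewrite /crep; case: (repr _).
Qed.

Lemma cinP (D : C) i j (f : mor (X i) D) (g : mor (X j) D) :
  cin f = cin g <->
  exists (k : pidx X) (hi : dir_le i k) (hj : dir_le j k), f ∘ ptr hi = g ∘ ptr hj.
Proof.
split=> [/eqmodP/asboolP//|h].
by apply/eqmodP/asboolP.
Qed.

Lemma cin_ptr (D : C) i j (h : dir_le i j) (f : mor (X i) D) : cin (f ∘ ptr h) = cin f.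
Proof.
apply/cinP; exists j, (dir_refl j), h.
by rewrite ptr_id comp_idr.
Qed.

Lemma cinW (D : C) (P : colimHom D -> Prop) :
  (forall i (f : mor (X i) D), P (cin f)) -> forall c, P c.
Proof. by move=> h c; rewrite -(crepK c). Qed.

Definition cpost (D D' : C) (g : mor D D') (c : colimHom D) : colimHom D' :=
  cin (g ∘ projT2 (crep c)).

Lemma cpost_in (D D' : C) (g : mor D D') i (f : mor (X i) D) :
  cpost g (cin f) = cin (g ∘ f).
Proof.
have /cinP[k [h1 [h2 e]]] := crepK (cin f).
by apply/cinP; exists k, h1, h2; rewrite -!comp_assoc e.
Qed.

Lemma cpost_comp (D D' D'' : C) (g : mor D' D'') (f : mor D D') c :
  cpost (g ∘ f) c = cpost g (cpost f c).
Proof. by elim/cinW: c => i h; rewrite !cpost_in comp_assoc. Qed.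

Lemma cpost_id (D : C) c : cpost (idm D) c = c.
Proof. by elim/cinW: c => i h; rewrite cpost_in comp_idl. Qed.

End ColimHom.

(* Elements of the inverse limit over j of the sets colimHom X (Y j). *)
Record proHom (C : category) (X Y : proOb C) := ProHom {
  pcomp :> forall j : pidx Y, colimHom X (Y j);
  pcompat : forall i j (h : dir_le i j), cpost (ptr h) (pcomp j) = pcomp i
}.

Lemma proHom_eq (C : category) (X Y : proOb C) (f g : proHom X Y) :
  (forall j, f j = g j) -> f = g.
Proof.
case: f g => [f hf] [g hg] /= fg.
have e : f = g := functional_extensionality_dep fg; subst g.
by rewrite (Prop_irrelevance hf hg).
Qed.

Section LevelMorphism.
Variables (C : category) (X Y : proOb C) (th : pidx Y -> pidx X).
Variable f : forall j, mor (X (th j)) (Y j).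
Hypothesis th_mono : forall i j, dir_le i j -> dir_le (th i) (th j).
Hypothesis f_nat : forall i j (h : dir_le i j),
  ptr h ∘ f j = f i ∘ ptr (th_mono h).

Fact pro_level_compat i j (h : dir_le i j) : cpost (ptr h) (cin (f j)) = cin (f i).
Proof. by rewrite cpost_in f_nat cin_ptr. Qed.

Definition pro_level : proHom X Y := ProHom pro_level_compat.
End LevelMorphism.

Section ProCategory.
Variable C : category.
Implicit Types X Y Z T : proOb C.

Fact pro_id_nat X i j (h : dir_le i j) :
  ptr h ∘ idm (X j) = idm (X i) ∘ ptr (id h).
Proof. by rewrite comp_idl comp_idr. Qed.

Definition pro_id X : proHom X X := pro_level (th_mono := fun _ _ h => h) (@pro_id_nat X).

Definition cpre X Y (f : proHom X Y) (D : C) (c : colimHom Y D) : colimHom X D :=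
  cpost (projT2 (crep c)) (f (projT1 (crep c))).

Lemma cpre_in X Y (f : proHom X Y) (D : C) j (g : mor (Y j) D) :
  cpre f (cin g) = cpost g (f j).
Proof.
have /cinP[k [h1 [h2 e]]] := crepK (cin g).
by rewrite /cpre -(pcompat f h1) -(pcompat f h2) -!cpost_comp e.
Qed.

Lemma cpre_post X Y (f : proHom X Y) (D D' : C) (g : mor D D') (c : colimHom Y D) :
  cpre f (cpost g c) = cpost g (cpre f c).
Proof. by elim/cinW: c => i h; rewrite cpost_in !cpre_in cpost_comp. Qed.

Fact pro_comp_compat X Y Z (g : proHom Y Z) (f : proHom X Y) i j (h : dir_le i j) :
  cpost (ptr h) (cpre f (g j)) = cpre f (g i).
Proof. by rewrite -cpre_post pcompat. Qed.

Definition pro_comp X Y Z (g : proHom Y Z) (f : proHom X Y) : proHom X Z :=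
  ProHom (pro_comp_compat g f).

Fact pro_idl X Y (f : proHom X Y) : pro_comp (pro_id Y) f = f.
Proof. by apply: proHom_eq => j /=; rewrite cpre_in cpost_id. Qed.

Fact pro_idr X Y (f : proHom X Y) : pro_comp f (pro_id X) = f.
Proof.
apply: proHom_eq => j /=; elim/cinW: (f j) => i h.
by rewrite cpre_in /= cpost_in comp_idr.
Qed.

Fact pro_assoc X Y Z T (h : proHom Z T) (g : proHom Y Z) (f : proHom X Y) :
  pro_comp h (pro_comp g f) = pro_comp (pro_comp h g) f.
Proof.
apply: proHom_eq => j /=; elim/cinW: (h j) => i k.
by rewrite !cpre_in /= cpost_comp.
Qed.

Definition Pro : category := Category pro_idl pro_idr pro_assoc.
End ProCategory.

(* Objects and morphisms of C as pro-objects over a one-element index set. *)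
Section Constant.
Variable C : category.

Definition cst_ob (D : C) : Pro C :=
  @ProOb C dir_unit (fun _ => D) (fun _ _ _ => idm D) (fun _ _ => erefl)
    (fun _ _ _ _ _ _ => comp_idl (idm D)).

Fact cst_nat (D D' : C) (f : mor D D') i j (h : @dir_le dir_unit i j) :
  @ptr C (cst_ob D') i j h ∘ f = f ∘ @ptr C (cst_ob D) i j h.
Proof. by rewrite /= comp_idl comp_idr. Qed.

Definition cst_map (D D' : C) (f : mor D D') : @mor (Pro C) (cst_ob D) (cst_ob D') :=
  @pro_level C (cst_ob D) (cst_ob D') id (fun _ => f) (fun _ _ h => h) (cst_nat f).

Fact cst_map_id D : cst_map (idm D) = idm (cst_ob D).
Proof. exact: proHom_eq. Qed.

Fact cst_map_comp (D D' D'' : C) (g : mor D' D'') (f : mor D D') :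
  cst_map (g ∘ f) = cst_map g ∘ cst_map f.
Proof. by apply: proHom_eq => j /=; rewrite cpre_in /= cpost_in. Qed.

Definition Cst : functor C (Pro C) := Functor cst_map_id cst_map_comp.
End Constant.

(* The levelwise extension of a functor to pro-objects. *)
Section ProFunctor.
Variables (C D : category) (F : functor C D).

Fact pro_fob_id (X : proOb C) i (h : dir_le i i) : fmap F (@ptr _ X _ _ h) = idm (F (X i)).
Proof. by rewrite ptr_id fmap_id. Qed.

Fact pro_fob_comp (X : proOb C) i j k (hij : dir_le i j) (hjk : dir_le j k)
    (hik : dir_le i k) :
  fmap F (@ptr _ X _ _ hij) ∘ fmap F (ptr hjk) = fmap F (ptr hik).
Proof. by rewrite -fmap_comp (ptr_comp hij hjk hik). Qed.

Definition pro_fob (X : proOb C) : proOb D :=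
  @ProOb D (pidx X) (fun i => F (X i)) (fun i j h => fmap F (ptr h))
    (@pro_fob_id X) (@pro_fob_comp X).

Definition colim_fmap (X : proOb C) (E : C) (c : colimHom X E) :
    colimHom (pro_fob X) (F E) :=
  @cin D (pro_fob X) (F E) (projT1 (crep c)) (fmap F (projT2 (crep c))).

Lemma colim_fmap_in (X : proOb C) (E : C) i (f : mor (X i) E) :
  colim_fmap (cin f) = @cin D (pro_fob X) (F E) i (fmap F f).
Proof.
have /cinP[k [h1 [h2 e]]] := crepK (cin f).
by apply/cinP; exists k, h1, h2; rewrite /= -!fmap_comp e.
Qed.

Lemma colim_fmap_post (X : proOb C) (E E' : C) (g : mor E E') (c : colimHom X E) :
  colim_fmap (cpost g c) = cpost (fmap F g) (colim_fmap c).
Proof. by elim/cinW: c => i f; rewrite cpost_in !colim_fmap_in cpost_in fmap_comp. Qed.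

Fact pro_fmap_compat (X Y : proOb C) (f : proHom X Y) i j (h : dir_le i j) :
  cpost (@ptr _ (pro_fob Y) _ _ h) (colim_fmap (f j)) = colim_fmap (f i).
Proof. by rewrite -colim_fmap_post pcompat. Qed.

Definition pro_fmap (X Y : proOb C) (f : proHom X Y) : proHom (pro_fob X) (pro_fob Y) :=
  ProHom (@pro_fmap_compat X Y f).

Fact pro_fmap_id (X : Pro C) : pro_fmap (idm X) = @idm (Pro D) (pro_fob X).
Proof. by apply: proHom_eq => j /=; rewrite colim_fmap_in fmap_id. Qed.

Fact pro_fmap_comp (X Y Z : Pro C) (g : mor Y Z) (f : mor X Y) :
  pro_fmap (g ∘ f) = @compm (Pro D) _ _ _ (pro_fmap g) (pro_fmap f).
Proof.
apply: proHom_eq => j /=; elim/cinW: (g j) => i h.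
by rewrite cpre_in colim_fmap_in cpre_in colim_fmap_post.
Qed.

Definition ProFunctor : functor (Pro C) (Pro D) :=
  @Functor (Pro C) (Pro D) pro_fob pro_fmap pro_fmap_id pro_fmap_comp.
End ProFunctor.

(* The levelwise extension, over product index sets, of a bifunctor to        *)
(* pro-objects.                                                               *)
Section ProBifunctor.
Variables (C D E : category) (F : functor (Prod C D) E).

Definition fmap2 (x x' : C) (y y' : D) (f : mor x x') (g : mor y y') :
    mor (F (x, y)) (F (x', y')) :=
  @fmap _ _ F (x, y) (x', y') (f, g).

Lemma fmap2_comp (x x' x'' : C) (y y' y'' : D) (f : mor x x') (f' : mor x' x'')
    (g : mor y y') (g' : mor y' y'') :
  fmap2 (f' ∘ f) (g' ∘ g) = fmap2 f' g' ∘ fmap2 f g.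
Proof. by rewrite -(fmap_comp F (_ : @mor (Prod C D) (x', y') (x'', y''))). Qed.

Lemma fmap2_id (x : C) (y : D) : fmap2 (idm x) (idm y) = idm (F (x, y)).
Proof. exact: (fmap_id F (x, y)). Qed.

Section Ob.
Variables (X : proOb C) (Y : proOb D).

Fact pro_fob2_id (p : dir_prod (pidx X) (pidx Y)) (h : dir_le p p) :
  fmap2 (@ptr _ X _ _ h.1) (@ptr _ Y _ _ h.2) = idm (F (X p.1, Y p.2)).
Proof. by rewrite !ptr_id fmap2_id. Qed.

Fact pro_fob2_comp (p q r : dir_prod (pidx X) (pidx Y)) (hpq : dir_le p q)
    (hqr : dir_le q r) (hpr : dir_le p r) :
  fmap2 (@ptr _ X _ _ hpq.1) (@ptr _ Y _ _ hpq.2) ∘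
  fmap2 (@ptr _ X _ _ hqr.1) (@ptr _ Y _ _ hqr.2) =
  fmap2 (@ptr _ X _ _ hpr.1) (@ptr _ Y _ _ hpr.2).
Proof. by rewrite -fmap2_comp (ptr_comp _ _ hpr.1) (ptr_comp _ _ hpr.2). Qed.

Definition pro_fob2 : proOb E :=
  @ProOb E (dir_prod (pidx X) (pidx Y)) (fun p => F (X p.1, Y p.2))
    (fun p q h => fmap2 (ptr h.1) (ptr h.2)) pro_fob2_id pro_fob2_comp.

Definition colim_fmap2 (x : C) (y : D) (c : colimHom X x) (d : colimHom Y y) :
    colimHom pro_fob2 (F (x, y)) :=
  @cin E pro_fob2 (F (x, y)) (projT1 (crep c), projT1 (crep d))
    (fmap2 (projT2 (crep c)) (projT2 (crep d))).

Lemma colim_fmap2_in (x : C) (y : D) i j (f : mor (X i) x) (g : mor (Y j) y) :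
  colim_fmap2 (cin f) (cin g) = @cin E pro_fob2 (F (x, y)) (i, j) (fmap2 f g).
Proof.
have /cinP[k [h1 [h2 e]]] := crepK (cin f).
have /cinP[l [h3 [h4 e']]] := crepK (cin g).
apply/cinP; exists (k, l).
exists (conj h1 h3 : @dir_le (dir_prod _ _) (_, _) (k, l)).
exists (conj h2 h4 : @dir_le (dir_prod _ _) (i, j) (k, l)).
rewrite /= -!fmap2_comp (Prop_irrelevance (proj1 (conj h1 h3)) h1).
rewrite (Prop_irrelevance (proj1 (conj h2 h4)) h2) (Prop_irrelevance (proj2 (conj h1 h3)) h3).
by rewrite (Prop_irrelevance (proj2 (conj h2 h4)) h4) e e'.
Qed.

Lemma colim_fmap2_post (x x' : C) (y y' : D) (f : mor x x') (g : mor y y')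
    (c : colimHom X x) (d : colimHom Y y) :
  colim_fmap2 (cpost f c) (cpost g d) = cpost (fmap2 f g) (colim_fmap2 c d).
Proof.
elim/cinW: c => i h; elim/cinW: d => j k.
rewrite [colim_fmap2 (cin h) (cin k)]colim_fmap2_in [RHS]cpost_in.
by rewrite [cpost f _]cpost_in [cpost g _]cpost_in colim_fmap2_in fmap2_comp.
Qed.
End Ob.

Section Hom.
Variables (X X' : proOb C) (Y Y' : proOb D) (f : proHom X X') (g : proHom Y Y').

Fact pro_fmap2_compat (p q : dir_prod (pidx X') (pidx Y')) (h : dir_le p q) :
  cpost (@ptr _ (pro_fob2 X' Y') _ _ h) (colim_fmap2 (f q.1) (g q.2)) =
  colim_fmap2 (f p.1) (g p.2).
Proof. by rewrite -colim_fmap2_post !pcompat. Qed.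

Definition pro_fmap2 : proHom (pro_fob2 X Y) (pro_fob2 X' Y') :=
  @ProHom E (pro_fob2 X Y) (pro_fob2 X' Y') (fun p => colim_fmap2 (f p.1) (g p.2))
    pro_fmap2_compat.
End Hom.

Fact pro_fmap2_id (X : Prod (Pro C) (Pro D)) :
  pro_fmap2 (idm X.1) (idm X.2) = @idm (Pro E) (pro_fob2 X.1 X.2).
Proof. by apply: proHom_eq => -[i j] /=; rewrite colim_fmap2_in fmap2_id. Qed.

Fact pro_fmap2_comp (X Y Z : Prod (Pro C) (Pro D)) (g : mor Y Z) (f : mor X Y) :
  pro_fmap2 (g.1 ∘ f.1) (g.2 ∘ f.2) =
  @compm (Pro E) _ _ _ (pro_fmap2 g.1 g.2) (pro_fmap2 f.1 f.2).
Proof.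
apply: proHom_eq => -[i j] /=.
elim/cinW: (g.1 i) => k h; elim/cinW: (g.2 j) => l h'.
rewrite [colim_fmap2 (cin h) (cin h')]colim_fmap2_in [RHS]cpre_in.
rewrite [cpre f.1 _]cpre_in [cpre f.2 _]cpre_in; exact: colim_fmap2_post.
Qed.

Definition ProBifunctor : functor (Prod (Pro C) (Pro D)) (Pro E) :=
  @Functor (Prod (Pro C) (Pro D)) (Pro E) (fun X => pro_fob2 X.1 X.2)
    (fun X Y f => pro_fmap2 f.1 f.2) pro_fmap2_id pro_fmap2_comp.
End ProBifunctor.

Arguments fmap2 {C D E} F {x x' y y'} f g.

Definition fin_dim (K : fieldType) (V : lmodType K) : Prop :=
  exists n : nat, inhabited (Vector.axiom n V).

(* The subalgebra generated by some finite list is everything. *)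
Definition fin_gen (K : fieldType) (A : pzAlgType K) : Prop :=
  exists s : seq A, forall S : {pred A},
    submod_closed S -> mulr_closed S -> {subset s <= S} -> forall x, x \in S.

Section Categories.
Variable K : fieldType.

Fact alg_idl (A B : pzAlgType K) (f : algHom A B) : algComp (algId B) f = f.
Proof. exact: algHom_eq. Qed.
Fact alg_idr (A B : pzAlgType K) (f : algHom A B) : algComp f (algId A) = f.
Proof. exact: algHom_eq. Qed.
Fact alg_assoc (A B C D : pzAlgType K) (h : algHom C D) (g : algHom B C) (f : algHom A B) :
  algComp h (algComp g f) = algComp (algComp h g) f.
Proof. exact: algHom_eq. Qed.

Definition Alg : category := Category alg_idl alg_idr alg_assoc.
Definition Alg_fg : category := FullSub (fun A : Alg => fin_gen A).
Definition ProAlg : category := Pro Alg.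
Definition ProAlg_fg : category := Pro Alg_fg.
Definition ProAlg_incl : functor ProAlg_fg ProAlg := ProFunctor (Incl _).

Fact Tens_id (X : Prod Alg Alg) :
  tens_algMap (algId X.1) (algId X.2) = @idm Alg (tens X.1 X.2).
Proof. by apply: algHom_eq => x; apply: tens_map_id. Qed.

Fact Tens_comp (X Y Z : Prod Alg Alg) (g : mor Y Z) (f : mor X Y) :
  tens_algMap (algComp g.1 f.1) (algComp g.2 f.2) =
  @compm Alg _ _ _ (tens_algMap g.1 g.2) (tens_algMap f.1 f.2).
Proof. by apply: algHom_eq => x; apply: tens_map_comp. Qed.

Definition Tens : functor (Prod Alg Alg) Alg :=
  @Functor (Prod Alg Alg) Alg (fun X => tens X.1 X.2)
    (fun X Y f => tens_algMap f.1 f.2) Tens_id Tens_comp.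

Definition ProTens : functor (Prod ProAlg ProAlg) ProAlg := ProBifunctor Tens.

Lemma tens_assoc_nat (A A' B B' C C' : Alg) (f : mor A A') (g : mor B B') (h : mor C C') :
  fmap2 Tens f (fmap2 Tens g h) ∘ (tens_assoc A B C : @mor Alg _ _) =
  (tens_assoc A' B' C' : @mor Alg _ _) ∘ fmap2 Tens (fmap2 Tens f g) h.
Proof. exact: tens_assoc_map. Qed.

Lemma tens_flip_nat (A A' B B' : Alg) (f : mor A A') (g : mor B B') :
  fmap2 Tens g f ∘ (tens_flip A B : @mor Alg _ _) =
  (tens_flip A' B' : @mor Alg _ _) ∘ fmap2 Tens f g.
Proof. exact: tens_flip_map. Qed.

(* The canonical identification of cst (A (x) B) with cst A (x) cst B, which  *)
(* are indexed by unit and unit * unit respectively.                          *)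
Section CstTens.
Variables A B : Alg.

Fact cst_tens_mono (i j : dir_prod dir_unit dir_unit) :
  dir_le i j -> @dir_le dir_unit tt tt.
Proof. by []. Qed.

Fact cst_tens_nat (i j : dir_prod dir_unit dir_unit) (h : dir_le i j) :
  @ptr _ (ProTens (Cst Alg A, Cst Alg B)) i j h ∘ idm (Tens (A, B)) =
  idm (Tens (A, B)) ∘ @ptr _ (Cst Alg (Tens (A, B))) tt tt (cst_tens_mono h).
Proof. by rewrite comp_idl comp_idr; exact: (fmap2_id (Tens) A B). Qed.

Definition cst_tens :
    @mor ProAlg (Cst Alg (Tens (A, B))) (ProTens (Cst Alg A, Cst Alg B)) :=
  @pro_level Alg (Cst Alg (Tens (A, B))) (ProTens (Cst Alg A, Cst Alg B))
    (fun _ => tt) (fun _ => idm (Tens (A, B))) cst_tens_mono cst_tens_nat.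
End CstTens.

Section ProAssoc.
Variables X Y Z : ProAlg.

Definition pro_assoc_idx (p : dir_prod (pidx X) (dir_prod (pidx Y) (pidx Z))) :
  dir_prod (dir_prod (pidx X) (pidx Y)) (pidx Z) := ((p.1, p.2.1), p.2.2).

Fact pro_assoc_mono p q : dir_le p q -> dir_le (pro_assoc_idx p) (pro_assoc_idx q).
Proof. by case=> ? []. Qed.

Fact pro_assoc_nat p q (h : dir_le p q) :
  @ptr _ (ProTens (X, ProTens (Y, Z))) p q h ∘
    (tens_assoc (X q.1) (Y q.2.1) (Z q.2.2) : @mor Alg _ _) =
  (tens_assoc (X p.1) (Y p.2.1) (Z p.2.2) : @mor Alg _ _) ∘
    @ptr _ (ProTens (ProTens (X, Y), Z)) _ _ (pro_assoc_mono h).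
Proof.
move: (pro_assoc_mono h) => h'.
rewrite (Prop_irrelevance h' (conj (conj h.1 h.2.1) h.2.2)) {h'}.
apply: (etrans (tens_assoc_nat (ptr h.1) (ptr h.2.1) (ptr h.2.2))).
congr (_ ∘ fmap2 Tens (fmap2 Tens _ _) _); congr ptr; exact: Prop_irrelevance.
Qed.

Definition pro_tens_assoc :
    @mor ProAlg (ProTens (ProTens (X, Y), Z)) (ProTens (X, ProTens (Y, Z))) :=
  @pro_level Alg (ProTens (ProTens (X, Y), Z)) (ProTens (X, ProTens (Y, Z)))
    pro_assoc_idx (fun p => tens_assoc (X p.1) (Y p.2.1) (Z p.2.2))
    pro_assoc_mono pro_assoc_nat.
End ProAssoc.

Section ProFlip.
Variables X Y : ProAlg.

Definition pro_flip_idx (p : dir_prod (pidx Y) (pidx X)) :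
  dir_prod (pidx X) (pidx Y) := (p.2, p.1).

Fact pro_flip_mono p q : dir_le p q -> dir_le (pro_flip_idx p) (pro_flip_idx q).
Proof. by case. Qed.

Fact pro_flip_nat p q (h : dir_le p q) :
  @ptr _ (ProTens (Y, X)) p q h ∘ (tens_flip (X q.2) (Y q.1) : @mor Alg _ _) =
  (tens_flip (X p.2) (Y p.1) : @mor Alg _ _) ∘
    @ptr _ (ProTens (X, Y)) _ _ (pro_flip_mono h).
Proof.
apply: (etrans (tens_flip_nat (ptr h.2) (ptr h.1))).
congr (_ ∘ fmap2 Tens _ _); congr ptr; exact: Prop_irrelevance.
Qed.

Definition pro_tens_flip : @mor ProAlg (ProTens (X, Y)) (ProTens (Y, X)) :=
  @pro_level Alg (ProTens (X, Y)) (ProTens (Y, X))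
    pro_flip_idx (fun p => tens_flip (X p.2) (Y p.1)) pro_flip_mono pro_flip_nat.
End ProFlip.

Variable H : hopfAlg K.

Fact comod_idl (V W : comodAlg H) (f : comodHom V W) : comodComp (comodId W) f = f.
Proof. exact/comodHom_eq/algHom_eq. Qed.
Fact comod_idr (V W : comodAlg H) (f : comodHom V W) : comodComp f (comodId V) = f.
Proof. exact/comodHom_eq/algHom_eq. Qed.
Fact comod_assoc (U V W X : comodAlg H) (h : comodHom W X) (g : comodHom V W)
    (f : comodHom U V) :
  comodComp h (comodComp g f) = comodComp (comodComp h g) f.
Proof. exact/comodHom_eq/algHom_eq. Qed.

Definition Comod : category := Category comod_idl comod_idr comod_assoc.
Definition Comod_fd : category := FullSub (fun V : Comod => fin_dim V).
Definition Comod_fg : category := FullSub (fun V : Comod => fin_gen V).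

Definition Forget : functor Comod Alg :=
  @Functor Comod Alg (fun V => comod_alg V) (fun V W f => comodHom_alg f)
    (fun _ => erefl) (fun _ _ _ _ _ => erefl).

End Categories.

Notation "A ⊗ B" := (fob (Tens _) (A, B)) (at level 35, right associativity).
Notation "f ⊗m g" := (fmap2 (Tens _) f g) (at level 35, right associativity).
Notation "X ⊗p Y" := (fob (ProTens _) (X, Y)) (at level 35, right associativity).
Notation "f ⊗pm g" := (fmap2 (ProTens _) f g) (at level 35, right associativity).

Section Families.
Variables (K : fieldType) (H : hopfAlg K).

Definition hopfA : Alg K := hopf_alg H.
Definition hopfP : ProAlg K := Cst (Alg K) hopfA.
Local Notation und := (fob (Forget H)).

Definition coactA (V : Comod H) : mor (und V) (und V ⊗ hopfA) := coact V.
Definition assocA (A B C : Alg K) : mor ((A ⊗ B) ⊗ C) (A ⊗ (B ⊗ C)) := tens_assoc A B C.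
Definition flipA (A B : Alg K) : mor (A ⊗ B) (B ⊗ A) := tens_flip A B.

(* (id_V (x) F) (rho (x) id_U) phi = (phi (x) id_H) rho', with the associativity *)
(* isomorphisms made explicit.                                                *)
Definition is_family (W V : Comod H) (U : Alg K) (phi : mor (und W) (und V ⊗ U)) : Prop :=
  (idm (und V) ⊗m flipA hopfA U) ∘ assocA (und V) hopfA U ∘ (coactA V ⊗m idm U) ∘ phi =
  assocA (und V) U hopfA ∘ (phi ⊗m idm hopfA) ∘ coactA W.

Definition pund : functor (Comod H) (ProAlg K) :=
  @Functor (Comod H) (ProAlg K) (fun V => Cst (Alg K) (und V))
    (fun V W f => fmap (Cst (Alg K)) (fmap (Forget H) f))
    (fun V => cst_map_id (und V)) (fun _ _ _ g f => cst_map_comp _ _).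

Definition coactP (V : Comod H) : mor (pund V) (pund V ⊗p hopfP) :=
  cst_tens (und V) hopfA ∘ fmap (Cst (Alg K)) (coactA V).

Definition is_profamily (W V : Comod H) (U : ProAlg K)
    (phi : mor (pund W) (pund V ⊗p U)) : Prop :=
  (idm (pund V) ⊗pm pro_tens_flip hopfP U) ∘ pro_tens_assoc (pund V) hopfP U ∘
    (coactP V ⊗pm idm U) ∘ phi =
  pro_tens_assoc (pund V) U hopfP ∘ (phi ⊗pm idm hopfP) ∘ coactP W.

End Families.

(* Main.v *)
Require Import Defs.
From HB Require Import structures.
From mathcomp Require Import all_boot all_algebra.
From mathcomp Require Import boolp classical_sets.

Set Implicit Arguments.
Unset Strict Implicit.
Unset Printing Implicit Defensive.

Import GRing.Theory.

(** Existence of the universal families rests on two facts.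

    Tensors are detected by functionals. For a finite list [s] of vectors of [V] there
    is a finite rank endomorphism of [V] that fixes the span of [s]
    ([dual_system_exists], from Zorn's lemma); hence an element of V ⊗ U is determined
    by its contractions with the functionals of [V] ([contract_inj]), and if morphisms
    A -> U_i are jointly injective then so are V ⊗ A -> V ⊗ U_i
    ([tens_jointly_injective]).

    Bounded families are represented. Fix a bound [sigma : W -> seq V] and consider
    all families phi : W -> V ⊗ U such that phi(w) is supported on [sigma w]. Each phi(w)
    is given by one formula in the coefficients of phi. Let A be the algebra
    generated by symbols for the coefficients, subject to all relations that
    hold in every such family; the evaluations of A at these families are then
    jointly injective by construction. The formula defines a map W -> V ⊗ A, and it is
    a family of comodule morphisms because all its evaluations are
    ([univ_map_family]). It is universal ([univ_map_universal]) and generic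
    ([univ_map_generic]), and A is finitely generated if W is
    ([univ_alg_fin_gen]).

    If V is finite dimensional, one constant bound covers all families, which
    gives part (i). In general every family has some bound; the
    algebras of all bounds, ordered by inclusion of supports, form the pro-algebra of
    part (ii) ([univ_pro_universal]). A morphism from a constant pro-object to
    V ⊗ U is a compatible system of ordinary morphisms, so that pro-families
    reduce to families index by index ([is_profamilyP]). Functoriality and naturality
    follow formally from universality ([universal_functor]). *)

(** * Separation by linear functionals *)

Section Functionals.
Local Open Scope ring_scope.
Variables (K : fieldType) (V : lmodType K).

Definition subspace (M : V -> Prop) : Prop :=
  M 0 /\ forall (a : K) x y, M x -> M y -> M (a *: x + y).

Lemma subspaceZ M a x : subspace M -> M x -> M (a *: x).
Proof. by case=> M0 ML Mx; rewrite -[a *: x]addr0; apply: ML. Qed.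

Lemma subspaceB M x y : subspace M -> M x -> M y -> M (x - y).
Proof. by move=> MV Mx My; rewrite -scaleN1r addrC; apply: MV.2. Qed.

(** Zorn's lemma over the subspaces containing [M] and avoiding [v]. Maximality
    of [N] says that adjoining any [x] outside [N] captures [v]; modulo [N], the
    vector [v] is then a multiple of [x], so that [N] is a hyperplane
    complementary to the line of [v]. *)
Lemma maximal_subspace_avoiding (M : V -> Prop) (v : V) : subspace M -> ~ M v ->
  exists N : V -> Prop, [/\ subspace N, forall x, M x -> N x, ~ N v
    & forall x, ~ N x -> exists2 c : K, c != 0 & N (v - c *: x)].
Proof.
move=> MV Mv.
(* The empty set is admitted so that the empty chain has an upper bound. *)
pose P (X : set V) := [/\ subspace X, ~ X v & forall x, M x -> X x] \/ X = set0.
have [F FP Ftot|N [PN Nmax]] := @Zorn_bigcup V P.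
  have [[X0 FX0 [y0 X0y0]]|F0] := pselect (exists2 X, F X & exists x, X x); last first.
    right; apply/seteqP; split=> // x [X FX Xx]; case: F0.
    by exists X => //; exists x.
  left; have good X y : F X -> X y -> [/\ subspace X, ~ X v & forall x, M x -> X x].
    by move=> /FP[//|->].
  have [[X00 _] _ MX0] := good _ _ FX0 X0y0.
  split; first split.
  - by exists X0.
  - move=> a x y [X FX Xx] [Y FY Yy].
    have [XY|YX] := Ftot X Y FX FY.
      exists Y => //; have [SY _ _] := good _ _ FY Yy.
      by apply: SY.2 => //; apply: XY.
    exists X => //; have [SX _ _] := good _ _ FX Xx.
    by apply: SX.2 => //; apply: YX.
  - by move=> [X FX Xv]; have [_ /(_ Xv)] := good _ _ FX Xv.
  - by move=> x Mx; exists X0 => //; apply: MX0.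
have [x0 Nx0] : exists x, N x.
  apply: contrapT => N0; apply: (Nmax M); last by left.
  by split=> [x Nx|/(_ 0 MV.1) N00]; case: N0; [exists x|exists 0].
have [[NV Nv MN]|NE] := PN; last by move: Nx0; rewrite NE.
exists N; split=> // x Nx.
pose Nx' (y : V) := exists2 c : K, True & N (y - c *: x).
have Nx'V : subspace Nx'.
  split=> [|a y z [c _ Ny] [d _ Nz]]; first by exists 0; rewrite // scale0r subr0; exact: NV.1.
  exists (a * c + d) => //; rewrite scalerDl -scalerA opprD addrACA -scalerBr.
  exact: NV.2.
have sNN' y : N y -> Nx' y by move=> Ny; exists 0; rewrite // scale0r subr0.
have [[c _ Nvc]|Nx'v] := pselect (Nx' v).
  exists c => //; apply/eqP => c0; apply: Nv.
  by move: Nvc; rewrite c0 scale0r subr0.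
case: (Nmax Nx').
  split=> [//|h]; apply: Nx; apply: h; exists 1 => //.
  by rewrite scale1r subrr; exact: NV.1.
by left; split=> // y /MN /sNN'.
Qed.

(** The coordinate along [v] modulo a hyperplane avoiding [v] and containing
    [M]. This replaces the choice of a basis of [V] throughout. *)
Lemma separating_functional (M : V -> Prop) (v : V) : subspace M -> ~ M v ->
  exists l : {linear V -> K^o}, l v = 1 /\ forall x, M x -> l x = 0.
Proof.
move=> MV Mv; have [N [NV MN Nv Nmax]] := maximal_subspace_avoiding MV Mv.
have coord x : exists c : K, N (x - c *: v).
  have [Nx|/Nmax[c c0 Nc]] := pselect (N x); first by exists 0; rewrite scale0r subr0.
  exists c^-1; have := subspaceZ (- c^-1) NV Nc.
  by rewrite scalerBr scalerA mulNr mulVf // scaleN1r opprK scaleNr addrC.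
have coordU x (c d : K) : N (x - c *: v) -> N (x - d *: v) -> c = d.
  move=> Nc Nd; apply: contrapT => /eqP cd; apply: Nv.
  have /(subspaceZ (d - c)^-1 NV) := subspaceB NV Nc Nd.
  rewrite opprB [_ + (_ - x)]addrC addrA subrK -scalerBl scalerA mulVf ?scale1r //.
  by rewrite subr_eq0 eq_sym.
pose l x : K^o := projT1 (cid (coord x)).
have lP x : N (x - (l x : K) *: v) := projT2 (cid (coord x)).
have lL (a : K) x y : l (a *: x + y) = a *: l x + l y.
  apply: (coordU (a *: x + y)) => //.
  rewrite scalerDl -[(a *: l x : K^o) *: v]scalerA opprD addrACA -scalerBr.
  by apply: NV.2.
pose L := HB.pack_for {linear V -> K^o} l (GRing.isLinear.Build K _ _ *:%R l lL).
exists L; split=> [|x /MN Nx].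
  by apply: (coordU v) => //; rewrite scale1r subrr; exact: NV.1.
by apply: (coordU x) => //; rewrite scale0r subr0.
Qed.

(** The element [\sum_(p <- d) p.1 ⊗ p.2] of V^* ⊗ V is an endomorphism of [V] of
    finite rank, with image in the span of [s] and restricting to the identity
    of that span. *)
Definition dual_system (s : seq V) (d : seq ({linear V -> K^o} * V)) : Prop :=
  {subset [seq p.2 | p <- d] <= s} /\
  forall v, v \in s -> \sum_(p <- d) (p.1 v : K) *: p.2 = v.

(** Induction on [s]. If the endomorphism [P] obtained for the tail does not fix
    the new vector [x], a functional [l] with [l x = 1] that vanishes on the fixed
    points of [P] corrects it to [v |-> P (v - l v *: x) + l v *: x]. *)
Lemma dual_system_exists (s : seq V) : exists d, dual_system s d.
Proof.
elim: s => [|x s [d [ds dP]]]; first by exists [::].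
pose P v := \sum_(p <- d) (p.1 v : K) *: p.2.
have PL (a : K) u v : P (a *: u + v) = a *: P u + P v.
  rewrite /P scaler_sumr -big_split; apply: eq_bigr => p _ /=.
  by rewrite linearP scalerDl -scalerA.
have [Px|Px] := pselect (P x = x).
  exists d; split=> v; first by move/ds; rewrite inE orbC => ->.
  by rewrite inE => /orP[/eqP->|/dP].
have PV : subspace (fun v => P v = v).
  split=> [|a u v Pu Pv]; last by rewrite PL Pu Pv.
  by rewrite /P big1 // => p _; rewrite linear0 scale0r.
have [l [lx l0]] := separating_functional PV Px.
pose C (p : {linear V -> K^o} * V) : {linear V -> K^o} :=
  (p.1 \- (p.1 x : K) \*: l)%R.
(* The functionals [C p] are those of [v |-> P (v - l v *: x)]. *)
exists ((l, x) :: [seq (C p, p.2) | p <- d]); split=> v.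
  by rewrite /= -map_comp !inE => /orP[->//|/ds->]; rewrite orbT.
move=> vs.
have -> : \sum_(p <- (l, x) :: [seq (C p, p.2) | p <- d]) (p.1 v : K) *: p.2 =
    (l v : K) *: x + (P v - (l v : K) *: P x).
  rewrite big_cons big_map; congr (_ + _).
  rewrite /P scaler_sumr -sumrB; apply: eq_bigr => p _ /=.
  by rewrite scalerBl scalerA mulrC.
move: vs; rewrite inE => /orP[/eqP->|/dP vs].
  by rewrite lx !scale1r subrr addr0.
by rewrite (l0 v vs) !scale0r subr0 add0r.
Qed.

End Functionals.

(** * Contractions and supports of tensors *)

Section TensorSums.
Local Open Scope ring_scope.
Variables (K : fieldType) (V U : lmodType K).

Lemma tens_mk0l (u : U) : (0 : V) ⊗t u = 0.
Proof. by rewrite -(scale0r (0 : V)) tens_mkZl scale0r. Qed.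

Lemma tens_mk0r (v : V) : v ⊗t (0 : U) = 0.
Proof. by rewrite -(scale0r (0 : U)) tens_mkZr scale0r. Qed.

Lemma tens_mk_suml (I : Type) (r : seq I) (F : I -> V) (u : U) :
  (\sum_(i <- r) F i) ⊗t u = \sum_(i <- r) F i ⊗t u.
Proof.
apply: (big_morph (fun v => v ⊗t u)) => [v v'|]; first exact: tens_mkDl.
exact: tens_mk0l.
Qed.

Lemma tens_mk_sumr (I : Type) (r : seq I) (v : V) (F : I -> U) :
  v ⊗t (\sum_(i <- r) F i) = \sum_(i <- r) v ⊗t F i.
Proof.
apply: (big_morph (tens_mk v)) => [u u'|]; first exact: tens_mkDr.
exact: tens_mk0r.
Qed.

End TensorSums.

Section Contraction.
Local Open Scope ring_scope.
Variables (K : fieldType) (V U : lmodType K).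

Lemma contract_bilin (l : {linear V -> K^o}) :
  bilin (fun (v : V) (u : U) => (l v : K) *: u).
Proof.
split=> [u a v v'|v a u u']; first by rewrite linearP scalerDl -scalerA.
by rewrite scalerDr !scalerA mulrC.
Qed.

Definition contract (l : {linear V -> K^o}) : tens V U -> U :=
  tens_lift (fun v u => (l v : K) *: u).

Lemma contract_mk l v u : contract l (v ⊗t u) = (l v : K) *: u.
Proof. exact: (tens_lift_mk (contract_bilin l)). Qed.

Fact contract_linear l (a : K) x y :
  contract l (a *: x + y) = a *: contract l x + contract l y.
Proof. exact: (tens_lift_linear (contract_bilin l)). Qed.

HB.instance Definition _ l :=
  GRing.isLinear.Build K _ _ *:%R (contract l) (contract_linear l).

(** [x] lies in the image of [span s ⊗ U]. Asking for a representative with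
    first components in [s] makes monotonicity in [s] immediate. *)
Definition tens_supp (s : seq V) (x : tens V U) : Prop :=
  exists2 t : seq (V * U), x = tcls t & {subset [seq p.1 | p <- t] <= s}.

Lemma tens_supp_sub (s s' : seq V) x :
  {subset s <= s'} -> tens_supp s x -> tens_supp s' x.
Proof. by move=> ss' [t -> ts]; exists t => // v /ts /ss'. Qed.

Lemma tens_supp_mk v (u : U) s : v \in s -> tens_supp s (v ⊗t u).
Proof. by move=> vs; exists [:: (v, u)] => // v'; rewrite inE => /eqP->. Qed.

Lemma tens_suppD s x y : tens_supp s x -> tens_supp s y -> tens_supp s (x + y).
Proof.
move=> [t -> ts] [t' -> t's]; exists (t ++ t'); first by rewrite tcls_cat.
by move=> v; rewrite map_cat mem_cat => /orP[/ts|/t's].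
Qed.

Lemma tens_supp0 s : tens_supp s (0 : tens V U).
Proof. by exists [::]. Qed.

Lemma tens_supp_sum s (I : Type) (r : seq I) (F : I -> tens V U) :
  (forall i, tens_supp s (F i)) -> tens_supp s (\sum_(i <- r) F i).
Proof. by move=> FP; elim/big_ind: _ => //; [exact: tens_supp0|exact: tens_suppD]. Qed.

Definition tens_support (x : tens V U) : seq V := [seq p.1 | p <- trep x].

Lemma tens_supportP x : tens_supp (tens_support x) x.
Proof. by exists (trep x); rewrite ?trepK. Qed.

(** The finite rank endomorphism given by [d] is the identity on the span of [s],
    hence so is its tensor product with [U] on [span s ⊗ U]. Thus the elements of
    [span s ⊗ U] are read off from finitely many contractions. *)
Lemma tens_dual_expansion (s : seq V) d (x : tens V U) :
  dual_system s d -> tens_supp s x -> x = \sum_(p <- d) p.2 ⊗t contract p.1 x.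
Proof.
move=> [_ dP] [t -> ts]; rewrite tcls_sum.
under [RHS]eq_bigr => p _ do rewrite linear_sum.
under [RHS]eq_bigr => p _ do rewrite tens_mk_sumr.
rewrite exchange_big /=; apply: eq_big_seq => q qt.
rewrite -{1}(dP q.1) ?ts ?map_f // tens_mk_suml; apply: eq_bigr => p _.
by rewrite contract_mk tens_mkZl tens_mkZr.
Qed.

(** Every tensor is supported on some finite list, whatever the dimension of
    [V]; expanding a difference there shows that functionals of [V] detect it. *)
Lemma contract_inj (x y : tens V U) :
  (forall l, contract l x = contract l y) -> x = y.
Proof.
move=> xy; apply/eqP; rewrite -subr_eq0; apply/eqP.
have [d dP] := dual_system_exists (tens_support (x - y)).
rewrite (tens_dual_expansion dP (tens_supportP _)) big1 // => p _.
by rewrite linearB /= xy subrr tens_mk0r.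
Qed.

End Contraction.

Section JointlyInjective.
Local Open Scope ring_scope.
Variable K : fieldType.

(** The map on the left factor is only asked to be pointwise the identity, so that
    the lemma applies to identities of algebras. *)
Lemma contract_map (V U U' : lmodType K) (i : {linear V -> V}) (f : {linear U -> U'})
    (l : {linear V -> K^o}) x :
  i =1 id -> contract l (tens_map i f x) = f (contract l x).
Proof.
move=> iE; apply: (tens_ext (f := fun x => contract l (tens_map i f x))
    (g := fun x => f (contract l x))) => [a {}x y|a {}x y|v u].
- by rewrite !linearP.
- by rewrite !linearP.
by rewrite tens_map_mk !contract_mk linearZ /= iE.
Qed.

Definition jointly_injective (A : Type) (I : Type) (U : I -> Type)
    (f : forall i, A -> U i) : Prop :=
  forall x y, (forall i, f i x = f i y) -> x = y.

(** Tensoring with a vector space preserves joint injectivity, because contractions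
    commute with [id ⊗ f i]. It is what allows equations in [V ⊗ A] to be checked in
    the [V ⊗ U i]. *)
Lemma tens_jointly_injective (V A : pzAlgType K) (I : Type) (U : I -> pzAlgType K)
    (f : forall i, algHom A (U i)) :
  jointly_injective (fun i => f i : A -> U i) ->
  jointly_injective (fun i => tens_algMap (algId V) (f i) : tens V A -> tens V (U i)).
Proof.
move=> fI x y xy; apply: contract_inj => l; apply: fI => i.
by rewrite -!(@contract_map _ _ _ (algId V)) //; congr contract; apply: xy.
Qed.

Lemma tens_jointly_injectivel (V A : pzAlgType K) (I : Type) (U : I -> pzAlgType K)
    (f : forall i, algHom A (U i)) :
  jointly_injective (fun i => f i : A -> U i) ->
  jointly_injective (fun i => tens_algMap (f i) (algId V) : tens A V -> tens (U i) V).
Proof.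
move=> fI x y xy.
have flipK (B C : pzAlgType K) : cancel (tens_flip B C) (tens_flip C B).
  move=> z; rewrite -[RHS]/(algId _ z) -[LHS]/(algComp _ _ z); congr (algHom_fun _ z).
  by apply: algHom_tens_eq => b c /=; rewrite !tens_flip_mk.
apply: (can_inj (flipK A V)); apply: (tens_jointly_injective fI) => i.
have e := tens_flip_map (f i) (algId V).
by have /= := congr1 (fun g : algHom _ _ => g x) e;
  have /= := congr1 (fun g : algHom _ _ => g y) e => -> ->;
  congr (tens_flip_fun _); apply: xy.
Qed.

End JointlyInjective.

(** * Algebras generated by families of values *)

Section JointlyGenerated.
Local Open Scope ring_scope.
Local Open Scope quotient_scope.
Variables (K : fieldType) (X : Type) (I : Type) (U : I -> pzAlgType K).
Variable a : forall i, X -> U i.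

Inductive term : Type :=
| TVar of X
| TZero
| TOne
| TLin of K & term & term
| TMul of term & term.

Fixpoint teval (i : I) (t : term) : U i :=
  match t with
  | TVar x => a i x
  | TZero => 0
  | TOne => 1
  | TLin c s t => c *: teval i s + teval i t
  | TMul s t => teval i s * teval i t
  end.

Definition teq (s t : {classic term}) : bool :=
  `[< forall i, teval i s = teval i t >].

Fact teq_equiv : equiv_class_of teq.
Proof.
split=> [s|s t|s t r].
- by apply/asboolP.
- by apply/asboolP/asboolP.
by move=> /asboolP h /asboolP h'; apply/asboolP => i; rewrite h.
Qed.

Canonical teq_equivRel := EquivRelPack teq_equiv.

(** The subalgebra of the product of the [U i] generated by the families
    [fun i => a i x], written as terms modulo equality of all their values. The
    product itself is avoided because [I] will be a large type, in a higher
    universe than the carriers of algebras; terms remain small. *)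
Definition genAlg : Type := {eq_quot teq}.

HB.instance Definition _ := Choice.on genAlg.

Definition gcls (t : term) : genAlg := \pi_({eq_quot teq}) (t : {classic term}).
Definition grep (x : genAlg) : term := repr (x : {eq_quot teq}).

Lemma grepK x : gcls (grep x) = x. Proof. exact: reprK. Qed.

Definition geval i (x : genAlg) : U i := teval i (grep x).

Lemma geval_cls i t : geval i (gcls t) = teval i t.
Proof. by have /eqmodP/asboolP := grepK (gcls t); apply. Qed.

Lemma geval_inj : jointly_injective geval.
Proof.
by move=> x y xy; rewrite -(grepK x) -(grepK y); apply/eqmodP/asboolP.
Qed.

Definition glin (c : K) x y := gcls (TLin c (grep x) (grep y)).
Definition gzero := gcls TZero.
Definition gone := gcls TOne.
Definition gadd x y := glin 1 x y.
Definition gscale c x := glin c x gzero.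
Definition gopp x := gscale (-1) x.
Definition gmul x y := gcls (TMul (grep x) (grep y)).
Definition gvar x := gcls (TVar x).

Lemma geval_lin i c x y : geval i (glin c x y) = c *: geval i x + geval i y.
Proof. exact: geval_cls. Qed.
Lemma geval0 i : geval i gzero = 0.
Proof. exact: geval_cls. Qed.
Lemma geval1 i : geval i gone = 1.
Proof. exact: geval_cls. Qed.
Lemma gevalD i x y : geval i (gadd x y) = geval i x + geval i y.
Proof. by rewrite geval_lin scale1r. Qed.
Lemma gevalZ i c x : geval i (gscale c x) = c *: geval i x.
Proof. by rewrite geval_lin geval0 addr0. Qed.
Lemma gevalN i x : geval i (gopp x) = - geval i x.
Proof. by rewrite gevalZ scaleN1r. Qed.
Lemma gevalM i x y : geval i (gmul x y) = geval i x * geval i y.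
Proof. exact: geval_cls. Qed.
Lemma geval_var i x : geval i (gvar x) = a i x.
Proof. exact: geval_cls. Qed.

Definition gevalE := (gevalD, gevalZ, gevalN, gevalM, geval0, geval1).

Fact gaddA : associative gadd.
Proof. by move=> x y z; apply: geval_inj => i; rewrite !gevalE addrA. Qed.
Fact gaddC : commutative gadd.
Proof. by move=> x y; apply: geval_inj => i; rewrite !gevalE addrC. Qed.
Fact gadd0 : left_id gzero gadd.
Proof. by move=> x; apply: geval_inj => i; rewrite !gevalE add0r. Qed.
Fact gaddN : left_inverse gzero gopp gadd.
Proof. by move=> x; apply: geval_inj => i; rewrite !gevalE addNr. Qed.

HB.instance Definition _ := GRing.isZmodule.Build genAlg gaddA gaddC gadd0 gaddN.

Fact gscaleA b c x : gscale b (gscale c x) = gscale (b * c) x.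
Proof. by apply: geval_inj => i; rewrite !gevalE scalerA. Qed.
Fact gscale1 : left_id 1 gscale.
Proof. by move=> x; apply: geval_inj => i; rewrite !gevalE scale1r. Qed.
Fact gscaleDr : right_distributive gscale +%R.
Proof. by move=> c x y; apply: geval_inj => i; rewrite !gevalE scalerDr. Qed.
Fact gscaleDl x : {morph gscale^~ x : b c / b + c}.
Proof. by move=> b c; apply: geval_inj => i; rewrite !gevalE scalerDl. Qed.

HB.instance Definition _ := GRing.Zmodule_isLmodule.Build K genAlg
  gscaleA gscale1 gscaleDr gscaleDl.

Fact gmulA : associative gmul.
Proof. by move=> x y z; apply: geval_inj => i; rewrite !gevalE mulrA. Qed.
Fact gmul1l : left_id gone gmul.
Proof. by move=> x; apply: geval_inj => i; rewrite !gevalE mul1r. Qed.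
Fact gmul1r : right_id gone gmul.
Proof. by move=> x; apply: geval_inj => i; rewrite !gevalE mulr1. Qed.
Fact gmulDl : left_distributive gmul +%R.
Proof. by move=> x y z; apply: geval_inj => i; rewrite !gevalE mulrDl. Qed.
Fact gmulDr : right_distributive gmul +%R.
Proof. by move=> x y z; apply: geval_inj => i; rewrite !gevalE mulrDr. Qed.
Fact gmulZl (c : K) x y : gmul (c *: x) y = c *: gmul x y.
Proof. by apply: geval_inj => i; rewrite !gevalE pzscalerAl. Qed.
Fact gmulZr (c : K) x y : gmul x (c *: y) = c *: gmul x y.
Proof. by apply: geval_inj => i; rewrite !gevalE pzscalerAr. Qed.

HB.instance Definition _ := Lmodule_isPzAlgebra.Build K genAlg
  gmulA gmul1l gmul1r gmulDl gmulDr gmulZl gmulZr.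

HB.instance Definition _ := GRing.PzRing.copy genAlg (PzAlgebra.sort (genAlg : pzAlgType K)).

Fact geval_linear i (c : K) (x y : genAlg) :
  geval i (c *: x + y) = c *: geval i x + geval i y.
Proof. by rewrite gevalD gevalZ. Qed.

Definition gevalHom i : algHom genAlg (U i) :=
  AlgHom (@geval_linear i) (geval1 i) (@gevalM i).

Lemma genAlg_generated (S : {pred genAlg}) :
  submod_closed S -> mulr_closed S -> (forall x, gvar x \in S) -> forall y, y \in S.
Proof.
move=> [S0 SL] [S1 SM] SX y; rewrite -(grepK y).
elim: (grep y) => [//||| c s Ss t St|s Ss t St].
- exact: S0.
- exact: S1.
- suff -> : gcls (TLin c s t) = c *: gcls s + gcls t by apply: SL.
  by apply: geval_inj => i; rewrite geval_linear !geval_cls.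
suff -> : gcls (TMul s t) = gcls s * gcls t by apply: SM.
by apply: geval_inj => i; rewrite [RHS]gevalM !geval_cls.
Qed.

End JointlyGenerated.

(** * Naturality of the coaction condition *)

Section FamilyStability.
Variables (K : fieldType) (H : hopfAlg K).
Local Notation und := (fob (Forget H)).
Local Notation HA := (hopfA H).

(** The two sides of the equation that defines families of comodule morphisms.
    Both are natural in [U], so that jointly injective morphisms out of [U]
    reflect families. *)
Definition family_lhs (W V : Comod H) (U : Alg K) (phi : mor (und W) (und V ⊗ U)) :
    mor (und W) (und V ⊗ (U ⊗ HA)) :=
  (idm (und V) ⊗m flipA HA U) ∘ assocA (und V) HA U ∘ (coactA V ⊗m idm U) ∘ phi.

Definition family_rhs (W V : Comod H) (U : Alg K) (phi : mor (und W) (und V ⊗ U)) :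
    mor (und W) (und V ⊗ (U ⊗ HA)) :=
  assocA (und V) U HA ∘ (phi ⊗m idm HA) ∘ coactA W.

Lemma assocA_nat (A A' B B' C C' : Alg K) (f : mor A A') (g : mor B B') (h : mor C C') :
  assocA A' B' C' ∘ ((f ⊗m g) ⊗m h) = (f ⊗m (g ⊗m h)) ∘ assocA A B C.
Proof. exact/esym/tens_assoc_nat. Qed.

Lemma flipA_nat (A A' B B' : Alg K) (f : mor A A') (g : mor B B') :
  flipA A' B' ∘ (f ⊗m g) = (g ⊗m f) ∘ flipA A B.
Proof. exact/esym/tens_flip_nat. Qed.

Lemma coactA_nat (V V' : Comod H) (f : mor V' V) :
  coactA V ∘ fmap (Forget H) f = (fmap (Forget H) f ⊗m idm HA) ∘ coactA V'.
Proof. exact/algHom_eq/comodHom_coact. Qed.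

Lemma family_lhs_push (W V : Comod H) (U U' : Alg K) (phi : mor (und W) (und V ⊗ U))
    (f : mor U U') :
  family_lhs ((idm (und V) ⊗m f) ∘ phi) =
  (idm (und V) ⊗m (f ⊗m idm HA)) ∘ family_lhs phi.
Proof.
rewrite /family_lhs !comp_assoc; congr (_ ∘ phi).
rewrite -comp_assoc -fmap2_comp comp_idr comp_idl.
rewrite -[in LHS](comp_idl (coactA V)) -[in LHS](comp_idr f) -fmap2_id fmap2_comp.
rewrite !comp_assoc; congr (_ ∘ _).
rewrite -comp_assoc assocA_nat !comp_assoc; congr (_ ∘ _).
by rewrite -!fmap2_comp flipA_nat.
Qed.

Lemma family_rhs_push (W V : Comod H) (U U' : Alg K) (phi : mor (und W) (und V ⊗ U))
    (f : mor U U') :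
  family_rhs ((idm (und V) ⊗m f) ∘ phi) =
  (idm (und V) ⊗m (f ⊗m idm HA)) ∘ family_rhs phi.
Proof.
rewrite /family_rhs !comp_assoc; congr (_ ∘ _).
by rewrite -[in LHS](comp_idl (idm HA)) fmap2_comp !comp_assoc assocA_nat.
Qed.

(** Stability under composition with comodule morphisms on both sides: the
    coactions slide through by equivariance, the rest by naturality of the
    associativity and flip isomorphisms. *)
Lemma is_family_pull (W W' V V' : Comod H) (U : Alg K) (g : mor W W') (f : mor V' V)
    (phi : mor (und W') (und V' ⊗ U)) : is_family phi ->
  is_family ((fmap (Forget H) f ⊗m idm U) ∘ phi ∘ fmap (Forget H) g).
Proof.
move=> phiF; transitivity ((fmap (Forget H) f ⊗m idm (U ⊗ HA)) ∘ family_lhs phi ∘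
    fmap (Forget H) g).
  rewrite /family_lhs !comp_assoc; congr (_ ∘ _ ∘ _).
  rewrite -comp_assoc -fmap2_comp coactA_nat comp_idl.
  rewrite -[in LHS](comp_idl (idm U)) fmap2_comp !comp_assoc; congr (_ ∘ _).
  rewrite -comp_assoc assocA_nat !comp_assoc; congr (_ ∘ _).
  by rewrite -!fmap2_comp fmap2_id !comp_idl !comp_idr.
rewrite [family_lhs phi](phiF : _ = family_rhs phi) /family_rhs.
rewrite -[X in _ = _ ∘ (_ ⊗m X) ∘ _](comp_idl (idm HA)) fmap2_comp.
rewrite -[X in _ = _ ∘ (_ ⊗m X ∘ _) ∘ _](comp_idl (idm HA)) fmap2_comp.
rewrite -!comp_assoc -coactA_nat !comp_assoc; congr (_ ∘ _ ∘ _ ∘ _).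
by rewrite assocA_nat fmap2_id.
Qed.

End FamilyStability.

(** * The universal family with a given bound *)

Section BoundedFamilies.
Local Open Scope ring_scope.
Variables (K : fieldType) (H : hopfAlg K) (W V : Comod H).

(** A bound prescribes, uniformly in [U], a finite list of vectors of [V] on which
    each [phi w] is supported. Families with a given bound have a representing
    algebra even if [V] has infinite dimension. *)
Definition bounded (sigma : W -> seq V) (U : pzAlgType K) (phi : W -> tens V U) : Prop :=
  forall w, tens_supp (sigma w) (phi w).

Variable sigma : W -> seq V.

Definition bounded_family : Type :=
  {U : pzAlgType K & {phi : algHom W (tens V U) |
     @is_family K H W V U phi /\ bounded sigma phi}}.

Definition bf_alg (m : bounded_family) : pzAlgType K := projT1 m.
Definition bf_map (m : bounded_family) : algHom W (tens V (bf_alg m)) := sval (projT2 m).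

(** Generated by the coefficients [contract l (phi w)] of all the families
    [phi] with bound [sigma]. A relation holds between the generators exactly
    if it holds between the coefficients of every such family. *)
Definition univ_alg : pzAlgType K :=
  genAlg (fun (m : bounded_family) (x : {linear V -> K^o} * W) => contract x.1 (bf_map m x.2)).

Definition univ_coef (l : {linear V -> K^o}) (w : W) : univ_alg := gvar _ (l, w).

Definition univ_eval (m : bounded_family) : algHom univ_alg (bf_alg m) := gevalHom _ m.

Lemma univ_eval_coef m l w : univ_eval m (univ_coef l w) = contract l (bf_map m w).
Proof. exact: geval_var. Qed.

Lemma univ_eval_inj : jointly_injective (fun m => univ_eval m : univ_alg -> bf_alg m).
Proof. exact: geval_inj. Qed.

Definition sigma_dual w : seq ({linear V -> K^o} * V) :=
  projT1 (cid (dual_system_exists (sigma w))).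

Lemma sigma_dualP w : dual_system (sigma w) (sigma_dual w).
Proof. exact: projT2 (cid (dual_system_exists (sigma w))). Qed.

(** The expansion that every family with bound [sigma] has at [w], with its
    coefficients replaced by generators. *)
Definition univ_fun (w : W) : tens V univ_alg :=
  \sum_(p <- sigma_dual w) p.2 ⊗t univ_coef p.1 w.

(** Evaluating the generators at a family recovers the family. With the joint
    injectivity of the evaluations, everything that all families satisfy passes
    to [univ_fun]: linearity, multiplicativity, compatibility with coactions. *)
Lemma univ_fun_eval m w :
  tens_algMap (algId V) (univ_eval m) (univ_fun w) = bf_map m w.
Proof.
rewrite linear_sum [RHS](tens_dual_expansion (sigma_dualP w)); last first.
  exact: (svalP (projT2 m)).2.
by apply: eq_bigr => p _; rewrite /= tens_map_mk /= -univ_eval_coef.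
Qed.

Definition univ_tens_inj := @tens_jointly_injective K V _ _ _ _ univ_eval_inj.

Fact univ_fun_linear (a : K) x y :
  univ_fun (a *: x + y) = a *: univ_fun x + univ_fun y.
Proof. by apply: univ_tens_inj => m; rewrite algHom_linear !univ_fun_eval algHom_linear. Qed.

Fact univ_fun1 : univ_fun 1 = 1.
Proof. by apply: univ_tens_inj => m; rewrite univ_fun_eval !algHom1. Qed.

Fact univ_funM x y : univ_fun (x * y) = univ_fun x * univ_fun y.
Proof. by apply: univ_tens_inj => m; rewrite algHomM !univ_fun_eval algHomM. Qed.

Definition univ_map : algHom W (tens V univ_alg) :=
  AlgHom univ_fun_linear univ_fun1 univ_funM.

Lemma univ_map_eval m : algComp (tens_algMap (algId V) (univ_eval m)) univ_map = bf_map m.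
Proof. by apply: algHom_eq => w; apply: univ_fun_eval. Qed.

Lemma univ_map_bounded : bounded sigma univ_map.
Proof.
move=> w; exists [seq (p.2, univ_coef p.1 w) | p <- sigma_dual w].
  by rewrite tcls_sum big_map.
by rewrite -map_comp; apply: (sigma_dualP w).1.
Qed.

(** Both sides of the equation take values in V ⊗ (A ⊗ H), where the evaluations of
    A are still jointly injective, and they agree after each of these. *)
Lemma univ_map_family : @is_family K H W V univ_alg univ_map.
Proof.
pose h : @mor (Alg K) (Forget H W) (Forget H V ⊗ (univ_alg : Alg K)) := univ_map.
suff: family_lhs h = family_rhs h by [].
apply: algHom_eq => w.
apply: (tens_jointly_injective (tens_jointly_injectivel (V := H) univ_eval_inj)) => m.
pose ev : @mor (Alg K) univ_alg (bf_alg m) := univ_eval m.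
have hE : (idm (Forget H V) ⊗m ev) ∘ h = bf_map m := univ_map_eval m.
have e : (idm (Forget H V) ⊗m (ev ⊗m idm (hopfA H))) ∘ family_lhs h =
    (idm (Forget H V) ⊗m (ev ⊗m idm (hopfA H))) ∘ family_rhs h.
  rewrite -family_lhs_push -family_rhs_push hE.
  exact: (svalP (projT2 m)).1.
exact: (congr1 (fun f : algHom _ _ => f w) e).
Qed.

Lemma contract_univ_map l w : contract l (univ_map w) = univ_coef l w.
Proof.
apply: univ_eval_inj => m; rewrite univ_eval_coef -univ_fun_eval.
by rewrite -[tens_algMap _ _ _]/(tens_map _ _ _) (contract_map (i := algId V)).
Qed.

(** The generators of the algebra are coefficients of [univ_map], so a morphism
    out of it is determined by what it does to [univ_map]. *)
Lemma univ_map_generic (U : pzAlgType K) (f f' : algHom univ_alg U) :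
  algComp (tens_algMap (algId V) f) univ_map = algComp (tens_algMap (algId V) f') univ_map ->
  f = f'.
Proof.
move=> ff'; apply: algHom_eq => y.
apply/eqP; rewrite -[_ == _]/(y \in [pred y | f y == f' y]).
apply: genAlg_generated => [||[l w]].
- split=> [|a u v]; rewrite !inE ?linear0 //.
  by rewrite !algHom_linear => /eqP-> /eqP->.
- split=> [|u v]; rewrite !inE ?algHom1 //.
  by rewrite !algHomM => /eqP-> /eqP->.
rewrite inE -[gvar _ _]/(univ_coef l w) -contract_univ_map.
have := congr1 (fun g : algHom W _ => contract l (g w)) ff'.
by rewrite /= !(contract_map (i := algId V)) // => ->.
Qed.

Lemma univ_map_universal (U : pzAlgType K) (phi : algHom W (tens V U)) :
  @is_family K H W V U phi -> bounded sigma phi ->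
  exists f : algHom univ_alg U, phi = algComp (tens_algMap (algId V) f) univ_map.
Proof.
move=> phiF phiB.
pose m : bounded_family := existT _ U (exist _ phi (conj phiF phiB)).
by exists (univ_eval m); apply/esym/(univ_map_eval m).
Qed.

(** If [G] generates [W], the finitely many coefficients of the expansions of
    [univ_map] at the elements of [G] suffice. If a subalgebra [S] contains them, then
    V ⊗ S contains the values of [univ_map] on [G], hence all its values as
    [univ_map] is an algebra morphism; so [S] contains all coefficients. *)
Lemma univ_alg_fin_gen : fin_gen W -> fin_gen univ_alg.
Proof.
case=> G Ggen; exists [seq univ_coef p.1 g | g <- G, p <- sigma_dual g] => S SL SM GS.
have coefS (t : seq (V * univ_alg)) l : all (fun p => p.2 \in S) t -> contract l (tcls t) \in S.
  move=> tS; rewrite tcls_sum linear_sum; rewrite big_seq; elim/big_ind: _ => [|x y|p pt].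
  - exact: SL.1.
  - by move=> xS yS; rewrite -[x]scale1r; apply: SL.2.
  rewrite /= contract_mk -[_ *: _]addr0; apply: SL.2; last exact: SL.1.
  exact: (allP tS).
(* [Q w] says that [univ_map w] lies in the image of V ⊗ S. *)
pose Q : {pred W} := fun w =>
  `[< exists2 t : seq (V * univ_alg), univ_map w = tcls t & all (fun p => p.2 \in S) t >].
have QT w : Q w.
  rewrite -[Q w]/(w \in Q); apply: (Ggen Q) => [||g gG].
  - split=> [|a x y].
      by apply/asboolP; exists [::] => //; rewrite linear0.
    move=> /asboolP[t tE tS] /asboolP[t' t'E t'S]; apply/asboolP.
    exists ([seq (a *: p.1, p.2) | p <- t] ++ t').
      rewrite algHom_linear tcls_cat -t'E tE; congr (_ + _); exact: tens_scalE.
    by rewrite all_cat all_map t'S andbT.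
  - split=> [|x y].
      apply/asboolP; exists [:: (1, 1)]; last by rewrite /= SM.1.
      by rewrite algHom1.
    move=> /asboolP[t tE tS] /asboolP[t' t'E t'S]; apply/asboolP.
    exists [seq (p.1 * q.1, p.2 * q.2) | p <- t, q <- t'].
      rewrite algHomM tE t'E !tcls_sum big_allpairs_dep mulr_suml.
      apply: eq_bigr => p _; rewrite mulr_sumr; apply: eq_bigr => q _.
      exact: tens_mkM.
    apply/allP => _ /allpairsP[[p q] /= [pt qt ->]] /=.
    by apply: SM.2; [exact: (allP tS)|exact: (allP t'S)].
  apply/asboolP.
  exists [seq (p.2, univ_coef p.1 g) | p <- sigma_dual g].
    by rewrite tcls_sum big_map.
  have : all (mem S) [seq univ_coef p.1 g | p <- sigma_dual g].
    apply/allP => x xg; apply: GS; apply/flattenP.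
    exists [seq univ_coef p.1 g | p <- sigma_dual g] => //.
    exact: (map_f (fun g => [seq univ_coef p.1 g | p <- sigma_dual g])).
  by rewrite !all_map.
move=> y; apply: genAlg_generated => // -[l w].
rewrite -[gvar _ _]/(univ_coef l w) -contract_univ_map.
by have /asboolP[t -> tS] := QT w; apply: coefS.
Qed.

End BoundedFamilies.

(** * From universal elements to functors *)

Definition fully_faithful (C D : category) (I : functor C D) : Prop :=
  forall (x y : C) (f : mor (I x) (I y)), exists! g : mor x y, fmap I g = f.

Definition functor_id (C : category) : functor C C :=
  @Functor C C id (fun _ _ f => f) (fun _ => erefl) (fun _ _ _ _ _ => erefl).

Section FunctorComposition.
Variables (C D E : category) (G : functor D E) (F : functor C D).

Fact functor_comp_id x : fmap G (fmap F (idm x)) = idm (G (F x)).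
Proof. by rewrite !fmap_id. Qed.

Fact functor_comp_comp x y z (g : mor y z) (f : mor x y) :
  fmap G (fmap F (g ∘ f)) = fmap G (fmap F g) ∘ fmap G (fmap F f).
Proof. by rewrite !fmap_comp. Qed.

Definition functor_comp : functor C E :=
  @Functor C E (fun x => G (F x)) (fun x y f => fmap G (fmap F f))
    functor_comp_id functor_comp_comp.
End FunctorComposition.

Lemma functor_id_fully_faithful (C : category) : fully_faithful (functor_id C).
Proof. by move=> x y f; exists f; split=> // g. Qed.

(** Representing objects chosen for each pair of objects assemble into a functor,
    because a morphism between them is determined by its effect on the universal
    element. The representing objects lie in [D], embedded by [I] in the category
    [D'] over which universality is tested; full faithfulness of [I] brings the
    induced morphisms back to [D]. *)
Section UniversalFunctor.
Variables (C1 C2 D D' : category) (u1 : functor C1 D') (u2 : functor C2 D').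
Variables (I : functor D D') (B : functor (Prod D' D') D').
Variable P : forall (W : C1) (V : C2) (U : D'), mor (u1 W) (B (u2 V, U)) -> Prop.

Hypothesis I_ff : fully_faithful I.
Hypothesis P_pull : forall (W W' : C1) (V V' : C2) (U : D') (g : mor W W')
    (f : mor V' V) (phi : mor (u1 W') (B (u2 V', U))),
  P phi -> P (fmap2 B (fmap u2 f) (idm U) ∘ phi ∘ fmap u1 g).
Hypothesis rep : forall (W : C1) (V : C2),
  exists (A : D) (h : mor (u1 W) (B (u2 V, I A))), P h /\
    forall (U : D') (phi : mor (u1 W) (B (u2 V, U))), P phi ->
    exists! f : mor (I A) U, phi = fmap2 B (idm (u2 V)) f ∘ h.

Theorem universal_functor :
  exists (A : functor (Prod C1 (Op C2)) D)
         (h : forall (W : C1) (V : C2), mor (u1 W) (B (u2 V, I (A (W, V))))),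
    [/\ forall W V, P (h W V),
        forall W V U (phi : mor (u1 W) (B (u2 V, U))), P phi ->
          exists! f : mor (I (A (W, V))) U, phi = fmap2 B (idm (u2 V)) f ∘ h W V
      & forall (W W' : C1) (V V' : C2) (g : mor W W') (f : mor V' V),
          fmap2 B (idm (u2 V)) (fmap I (@fmap _ _ A (W, V) (W', V') (g, f))) ∘ h W V =
          fmap2 B (fmap u2 f) (idm (I (A (W', V')))) ∘ h W' V' ∘ fmap u1 g].
Proof.
pose A W V := projT1 (cid (rep W V)).
pose h W V : mor (u1 W) (B (u2 V, I (A W V))) := projT1 (cid (projT2 (cid (rep W V)))).
have [hP hU] : (forall W V, P (h W V)) /\
    (forall W V U (phi : mor (u1 W) (B (u2 V, U))), P phi ->
      exists! f : mor (I (A W V)) U, phi = fmap2 B (idm (u2 V)) f ∘ h W V).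
  by split=> W V; have [] := projT2 (cid (projT2 (cid (rep W V)))).
have I_inj (x y : D) (a b : mor x y) : fmap I a = fmap I b -> a = b.
  by move=> ab; have [c [_ cU]] := I_ff (fmap I a); rewrite -(cU a) // (cU b).
(* The value of the functor at [m] is the only [a] with [induced x y m a]. *)
pose induced (x y : Prod C1 (Op C2)) (m : mor x y) (a : mor (A x.1 x.2) (A y.1 y.2)) :=
  fmap2 B (idm (u2 x.2)) (fmap I a) ∘ h x.1 x.2 =
  fmap2 B (fmap u2 m.2) (idm (I (A y.1 y.2))) ∘ h y.1 y.2 ∘ fmap u1 m.1.
have induced_ex x y m : exists a, induced x y m a.
  have [f [fE _]] := hU _ _ _ _ (P_pull m.1 m.2 (hP y.1 y.2)).
  by have [a [aE _]] := I_ff f; exists a; rewrite /induced aE -fE.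
have induced_uniq x y m a a' : induced x y m a -> induced x y m a' -> a = a'.
  move=> aE a'E; apply: I_inj.
  have [f [_ fU]] := hU _ _ _ _ (P_pull m.1 m.2 (hP y.1 y.2)).
  by rewrite -(fU (fmap I a)) // -(fU (fmap I a')).
pose F x y m := projT1 (cid (induced_ex x y m)).
have FE x y m : induced x y m (F x y m) := projT2 (cid (induced_ex x y m)).
have F_id x : F x x (idm x) = idm (A x.1 x.2).
  apply: induced_uniq (FE _ _ _) _.
  by rewrite /induced !fmap_id comp_idr.
have F_comp x y z (g : mor y z) (f : mor x y) : F x z (g ∘ f) = F y z g ∘ F x y f.
  apply: induced_uniq (FE _ _ _) _; rewrite /induced.
  rewrite fmap_comp -[in LHS](comp_idl (idm (u2 x.2))) fmap2_comp -comp_assoc.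
  rewrite (FE x y f) !comp_assoc -fmap2_comp comp_idl comp_idr.
  rewrite -[in LHS](comp_idr (fmap u2 f.2)) -[in LHS](comp_idl (fmap I _)) fmap2_comp.
  rewrite -[X in X ∘ _]comp_assoc (FE y z g) !comp_assoc -fmap2_comp comp_idl.
  by rewrite -!fmap_comp -[X in X = _]comp_assoc -fmap_comp.
exists (@Functor (Prod C1 (Op C2)) D (fun x => A x.1 x.2) F F_id F_comp), h.
split=> //.
by move=> W W' V V' g f; apply: (FE (W, V) (W', V') (g, f)).
Qed.
End UniversalFunctor.

(** * Pro-families as systems of families *)

Section ProInclusion.
Variables (C : category) (P : C -> Prop).
Local Notation I := (@Incl C P).

Lemma colim_fmap_incl_inj (X : proOb (FullSub P)) (E : FullSub P) :
  injective (@colim_fmap _ _ I X E).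
Proof.
move=> c d; elim/cinW: c => i f; elim/cinW: d => j g.
by rewrite !colim_fmap_in => /cinP h; apply/cinP.
Qed.

Lemma colim_fmap_incl_surj (X : proOb (FullSub P)) (E : FullSub P)
    (c : colimHom (pro_fob I X) (I E)) : exists d : colimHom X E, colim_fmap I d = c.
Proof.
elim/cinW: c => i f.
by exists (@cin (FullSub P) X E i f); rewrite colim_fmap_in.
Qed.

Lemma pro_incl_fully_faithful : fully_faithful (ProFunctor I).
Proof.
move=> X Y f; pose g j := projT1 (cid (colim_fmap_incl_surj (f j))).
have gE j : colim_fmap I (g j) = f j := projT2 (cid (colim_fmap_incl_surj (f j))).
have gC i j (h : dir_le i j) : cpost (@ptr _ Y i j h) (g j) = g i.
  apply: colim_fmap_incl_inj; rewrite colim_fmap_post !gE.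
  exact: (pcompat (f : proHom _ _)).
exists (ProHom gC); split=> [|g' g'E]; first exact: proHom_eq.
apply: proHom_eq => j; apply: colim_fmap_incl_inj; rewrite gE.
by rewrite -g'E.
Qed.

End ProInclusion.

Section ProFamilies.
Variables (K : fieldType) (H : hopfAlg K).
Local Notation und := (fob (Forget H)).
Local Notation HA := (hopfA H).

Lemma cst_cinP (C : category) (x y : C) (f g : mor x y) :
  @cin C (Cst C x) y tt f = @cin C (Cst C x) y tt g <-> f = g.
Proof.
split=> [/cinP[k [h [h' /=]]]|->//].
by rewrite !comp_idr.
Qed.

Lemma cst_cin_surj (C : category) (x y : C) (c : colimHom (Cst C x) y) :
  exists f : mor x y, @cin C (Cst C x) y tt f = c.
Proof. by elim/cinW: c => -[] f; exists f. Qed.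

Definition pro_member (W V : Comod H) (U : ProAlg K) (phi : mor (pund H W) (pund H V ⊗p U))
    (j : pidx U) : colimHom (pund H W) (und V ⊗ U j) :=
  Defs.pcomp phi ((tt, j) : dir_prod dir_unit (pidx U)).

Lemma pro_member_eq (W V : Comod H) (U : ProAlg K)
    (phi psi : mor (pund H W) (pund H V ⊗p U)) :
  (forall j, pro_member phi j = pro_member psi j) -> phi = psi.
Proof. by move=> e; apply: proHom_eq => -[[] j]; apply: e. Qed.

(** A morphism from the constant pro-object of [W] to [V ⊗ U] is a compatible system
    of ordinary morphisms, one for each index of [U], and the coaction condition
    is tested index by index: [V] and [H] being constant, the indices of
    V ⊗ (U ⊗ H) are those of [U]. *)
Lemma is_profamilyP (W V : Comod H) (U : ProAlg K) (phi : mor (pund H W) (pund H V ⊗p U))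
    (f : forall j, mor (und W) (und V ⊗ U j)) :
  (forall j, @cin _ (pund H W) _ tt (f j) = pro_member phi j) ->
  is_profamily phi <-> forall j, is_family (f j).
Proof.
move=> fE.
pose lhs := (idm (pund H V) ⊗pm pro_tens_flip (hopfP H) U) ∘
    pro_tens_assoc (pund H V) (hopfP H) U ∘ (coactP V ⊗pm idm U) ∘ phi.
pose rhs := pro_tens_assoc (pund H V) U (hopfP H) ∘ (phi ⊗pm idm (hopfP H)) ∘ coactP W.
have lhsE j : Defs.pcomp lhs ((tt, (j, tt)) : dir_prod dir_unit (dir_prod (pidx U) dir_unit)) =
    @cin _ (pund H W) _ tt (family_lhs (f j)).
  rewrite /lhs /=.
  rewrite colim_fmap2_in (cpre_in (pro_tens_assoc _ _ _)) /= cpost_in.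
  rewrite (cpre_in (pro_fmap2 _ _ _)) /= (cpre_in (cst_map _)) /= cpost_in.
  rewrite colim_fmap2_in cpost_in (cpre_in phi) -[phi _]/(pro_member phi j) -fE.
  by rewrite cpost_in (comp_idl (c := Alg K)).
have rhsE j : Defs.pcomp rhs ((tt, (j, tt)) : dir_prod dir_unit (dir_prod (pidx U) dir_unit)) =
    @cin _ (pund H W) _ tt (family_rhs (f j)).
  rewrite /rhs /= (cpre_in (pro_fmap2 _ _ _)) /= -[phi _]/(pro_member phi j) -fE.
  rewrite colim_fmap2_in cpost_in (cpre_in (coactP W)) /= (cpre_in (cst_map _)) /=.
  by rewrite !cpost_in (comp_idl (c := Alg K)).
split=> [e j|e].
  by apply/cst_cinP; rewrite -[LHS]lhsE -[RHS]rhsE (_ : lhs = rhs).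
apply: proHom_eq => -[[] [j []]]; rewrite [LHS]lhsE [RHS]rhsE; apply/cst_cinP; exact: e.
Qed.

Lemma is_profamily_pull (W W' V V' : Comod H) (U : ProAlg K) (g : mor W W')
    (f : mor V' V) (phi : mor (pund H W') (pund H V' ⊗p U)) :
  is_profamily phi ->
  is_profamily ((fmap (pund H) f ⊗pm idm U) ∘ phi ∘ fmap (pund H) g).
Proof.
pose p j := projT1 (cid (cst_cin_surj (pro_member phi j))).
have pE j : @cin _ (pund H W') _ tt (p j) = pro_member phi j :=
  projT2 (cid (cst_cin_surj (pro_member phi j))).
move/(is_profamilyP pE) => pF.
apply/(@is_profamilyP _ _ _ _ (fun j =>
  (fmap (Forget H) f ⊗m idm (U j)) ∘ p j ∘ fmap (Forget H) g)) => [j|j].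
  rewrite /pro_member /= colim_fmap2_in (cpre_in phi) -[phi _]/(pro_member phi j) -pE.
  by rewrite cpost_in (cpre_in (cst_map _)) /= cpost_in.
exact: is_family_pull.
Qed.

End ProFamilies.

(** * The universal pro-family *)

Section UniversalProFamily.
Variables (K : fieldType) (H : hopfAlg K) (W V : Comod H).
Hypothesis Wfg : fin_gen W.

Definition bound_le (sigma tau : W -> seq V) : Prop :=
  forall w, {subset sigma w <= tau w}.

Fact bound_refl sigma : bound_le sigma sigma.
Proof. by move=> w v. Qed.

Fact bound_trans rho sigma tau :
  bound_le rho sigma -> bound_le sigma tau -> bound_le rho tau.
Proof. by move=> rs st w v /rs/st. Qed.

Fact bound_ub sigma tau : exists rho, bound_le sigma rho /\ bound_le tau rho.
Proof.
by exists (fun w => sigma w ++ tau w); split=> w v vw; rewrite mem_cat vw ?orbT.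
Qed.

Fact bound_inh : inhabited (W -> seq V).
Proof. exact: (inhabits (fun=> [::])). Qed.

(** The larger the bound, the more families it admits, hence transition
    morphisms from the algebra of a larger bound to that of a smaller one. *)
Definition bounds : dirset := Dirset bound_refl bound_trans bound_ub bound_inh.

Lemma push_comp (X Y A B C : Alg K) (f : mor B C) (g : mor A B) (phi : mor X (Y ⊗ A)) :
  (idm Y ⊗m (f ∘ g)) ∘ phi = (idm Y ⊗m f) ∘ ((idm Y ⊗m g) ∘ phi).
Proof. by rewrite -{1}(comp_idl (idm Y)) fmap2_comp comp_assoc. Qed.

Definition univ_mor (sigma : bounds) :
  @mor (Alg K) (Forget H W) (Forget H V ⊗ (univ_alg sigma : Alg K)) := univ_map sigma.

Lemma univ_mor_cancel (sigma : bounds) (U : Alg K)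
    (f f' : @mor (Alg K) (univ_alg sigma) U) :
  (idm (Forget H V) ⊗m f) ∘ univ_mor sigma = (idm (Forget H V) ⊗m f') ∘ univ_mor sigma ->
  f = f'.
Proof. exact: univ_map_generic. Qed.

Lemma univ_mor_factor (sigma : bounds) (U : Alg K)
    (phi : @mor (Alg K) (Forget H W) (Forget H V ⊗ U)) :
  is_family phi -> bounded sigma (phi : algHom W (tens V U)) ->
  exists f : @mor (Alg K) (univ_alg sigma) U, phi = (idm (Forget H V) ⊗m f) ∘ univ_mor sigma.
Proof. exact: univ_map_universal. Qed.

Lemma univ_tr_ex (sigma tau : bounds) : dir_le sigma tau ->
  exists f : @mor (Alg K) (univ_alg tau) (univ_alg sigma),
    univ_mor sigma = (idm (Forget H V) ⊗m f) ∘ univ_mor tau.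
Proof.
move=> st; apply: univ_mor_factor; first exact: univ_map_family.
by move=> w; apply: tens_supp_sub (st w) (univ_map_bounded _ _).
Qed.

Definition univ_tr (sigma tau : bounds) (st : dir_le sigma tau) :
  @mor (Alg K) (univ_alg tau) (univ_alg sigma) := projT1 (cid (univ_tr_ex st)).

Lemma univ_trE (sigma tau : bounds) (st : dir_le sigma tau) :
  univ_mor sigma = (idm (Forget H V) ⊗m univ_tr st) ∘ univ_mor tau.
Proof. exact: projT2 (cid (univ_tr_ex st)). Qed.

Definition univ_fg (sigma : bounds) : Alg_fg K :=
  exist (fun A : Alg K => fin_gen A) (univ_alg sigma) (univ_alg_fin_gen sigma Wfg).

Fact univ_tr_id (sigma : bounds) (ss : dir_le sigma sigma) :
  univ_tr ss = @idm (Alg_fg K) (univ_fg sigma).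
Proof. by apply: univ_mor_cancel; rewrite -univ_trE fmap2_id comp_idl. Qed.

Fact univ_tr_comp (rho sigma tau : bounds) (rs : dir_le rho sigma)
    (st : dir_le sigma tau) (rt : dir_le rho tau) :
  univ_tr rs ∘ univ_tr st = univ_tr rt.
Proof.
by apply: univ_mor_cancel; rewrite push_comp -!univ_trE.
Qed.

Definition univ_pro : ProAlg_fg K :=
  @ProOb (Alg_fg K) bounds univ_fg univ_tr univ_tr_id univ_tr_comp.

Fact univ_pro_compat (p q : dir_prod dir_unit bounds) (h : dir_le p q) :
  cpost (@ptr _ (pund H V ⊗p ProAlg_incl K univ_pro) p q h)
    (@cin _ (pund H W) _ tt (univ_mor q.2)) = @cin _ (pund H W) _ tt (univ_mor p.2).
Proof. by rewrite cpost_in; congr cin; apply/esym/(univ_trE h.2). Qed.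

Definition univ_pro_map : mor (pund H W) (pund H V ⊗p ProAlg_incl K univ_pro) :=
  @ProHom _ (pund H W) (pund H V ⊗p ProAlg_incl K univ_pro)
    (fun p => @cin _ (pund H W) _ tt (univ_mor p.2)) univ_pro_compat.

Lemma univ_pro_family : is_profamily univ_pro_map.
Proof.
apply/(@is_profamilyP K H W V (ProAlg_incl K univ_pro) univ_pro_map univ_mor) => sigma //.
exact: univ_map_family.
Qed.

(** The components of [fun psi => (id ⊗ psi) ∘ univ_pro_map], as maps between direct
    limits of sets of morphisms. Universality of [univ_pro_map] amounts to the
    injectivity of these maps and to their image containing all families. *)
Definition colim_push (D : Alg K) (c : colimHom (ProAlg_incl K univ_pro) D) :
    colimHom (pund H W) (Forget H V ⊗ D) :=
  cpre univ_pro_map (colim_fmap2 (Tens K) (@cin _ (pund H V) _ tt (idm (Forget H V))) c).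

Lemma colim_push_in (D : Alg K) (sigma : bounds) (f : @mor (Alg K) (univ_alg sigma) D) :
  colim_push (@cin _ (ProAlg_incl K univ_pro) D sigma f) =
  @cin _ (pund H W) _ tt ((idm (Forget H V) ⊗m f) ∘ univ_mor sigma).
Proof. by rewrite /colim_push colim_fmap2_in cpre_in cpost_in. Qed.

Lemma colim_push_inj (D : Alg K) : injective (@colim_push D).
Proof.
move=> c d; elim/cinW: c => sigma f; elim/cinW: d => tau g.
rewrite !colim_push_in => /cst_cinP fg.
have [rho [sr tr]] := dir_ub sigma tau.
apply/cinP; exists rho, sr, tr; apply: univ_mor_cancel.
by rewrite !push_comp -(univ_trE sr) -(univ_trE tr).
Qed.

Lemma colim_push_post (D D' : Alg K) (f : mor D D') c :
  colim_push (cpost f c) = cpost (idm (Forget H V) ⊗m f) (colim_push c).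
Proof.
elim/cinW: c => sigma g; by rewrite cpost_in !colim_push_in cpost_in push_comp.
Qed.

(** Each member of a pro-family is an ordinary family, which is bounded by its
    own supports and so factors through one of the algebras. Injectivity of
    [colim_push] makes these factorizations compatible and unique. *)
Lemma univ_pro_universal (U : ProAlg K) (phi : mor (pund H W) (pund H V ⊗p U)) :
  is_profamily phi ->
  exists! phihat : mor (ProAlg_incl K univ_pro) U,
    phi = (idm (pund H V) ⊗pm phihat) ∘ univ_pro_map.
Proof.
move=> phiF.
pose f j := projT1 (cid (cst_cin_surj (pro_member phi j))).
have fE j : @cin _ (pund H W) _ tt (f j) = pro_member phi j :=
  projT2 (cid (cst_cin_surj (pro_member phi j))).
have fF : forall j, is_family (f j) by apply/(is_profamilyP fE).
have gex j : exists c, colim_push c = pro_member phi j.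
  have [g gE] := @univ_mor_factor (fun w => tens_support ((f j : algHom _ _) w)) _ _ (fF j)
    (fun w => tens_supportP _).
  by exists (@cin _ (ProAlg_incl K univ_pro) _ _ g); rewrite colim_push_in -gE.
pose g j := projT1 (cid (gex j)).
have gE j : colim_push (g j) = pro_member phi j := projT2 (cid (gex j)).
have gC i j (h : dir_le i j) : cpost (ptr h) (g j) = g i.
  apply: colim_push_inj; rewrite colim_push_post !gE.
  (* [h'.2] and [h] are proofs of the same comparison. *)
  pose h' : @dir_le (dir_prod dir_unit (pidx U)) (tt, i) (tt, j) := conj I h.
  rewrite (Prop_irrelevance h h'.2).
  exact: (@pcompat _ (pund H W) (pund H V ⊗p U) phi (tt, i) (tt, j) h').
exists (ProHom gC); split=> [|g' g'E].
  by apply: pro_member_eq => j; rewrite -gE.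
by apply: proHom_eq => j; apply: colim_push_inj; rewrite gE g'E.
Qed.

End UniversalProFamily.

(** * Universal families of comodule morphisms *)

(** The coordinate vectors support every tensor, so that in finite dimension
    a single constant bound serves all families. *)
Lemma fin_dim_spanned (K : fieldType) (V : lmodType K) : fin_dim V ->
  exists s : seq V, forall (U : lmodType K) (x : tens V U), tens_supp s x.
Proof.
case=> n [[v2r v2rL [r2v v2rK r2vK]]].
pose f := HB.pack_for {linear V -> 'rV[K]_n} v2r (GRing.isLinear.Build K _ _ *:%R v2r v2rL).
pose e i : V := r2v (delta_mx ord0 i).
have vE v : v = (\sum_i v2r v ord0 i *: e i)%R.
  apply: (can_inj v2rK); rewrite -[RHS]/(f _) linear_sum [LHS]row_sum_delta.
  by apply: eq_bigr => i _; rewrite linearZ /= r2vK.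
exists [seq e i | i <- enum 'I_n] => U; elim/tens_ind => [|x y xs ys|v u].
- exact: tens_supp0.
- exact: tens_suppD.
have -> : v ⊗t u = (\sum_i e i ⊗t (v2r v ord0 i *: u))%R.
  rewrite {1}(vE v) tens_mk_suml; apply: eq_bigr => i _.
  by rewrite tens_mkZl tens_mkZr.
apply: tens_supp_sum => i; apply: tens_supp_mk.
by apply: map_f; rewrite mem_enum.
Qed.

Lemma universal_family_fd (K : fieldType) (H : hopfAlg K) (W V : Comod H) : fin_dim V ->
  exists (A : Alg K) (h : mor (Forget H W) (Forget H V ⊗ A)), is_family h /\
    forall (U : Alg K) (phi : mor (Forget H W) (Forget H V ⊗ U)), is_family phi ->
    exists! f : mor A U, phi = (idm (Forget H V) ⊗m f) ∘ h.
Proof.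
case/fin_dim_spanned => s sP; pose sigma (w : W) := s.
exists (univ_alg sigma), (univ_map sigma); split; first exact: univ_map_family.
move=> U phi phiF; have [f fE] := univ_map_universal phiF (fun w => sP U (phi w)).
exists f; split=> // g gE.
by apply: (@univ_map_generic _ _ _ _ sigma) (etrans (esym fE) gE).
Qed.

Theorem theorem4p2 (K : fieldType) (H : hopfAlg K) :
  (exists (A : functor (Prod (Comod H) (Op (Comod_fd H))) (Alg K))
          (h : forall (W : Comod H) (V : Comod_fd H),
             mor (Forget H W) (Forget H (sval V) ⊗ A (W, V))),
    [/\ forall (W : Comod H) (V : Comod_fd H), is_family (h W V),
        forall (W : Comod H) (V : Comod_fd H) (U : Alg K)
          (phi : mor (Forget H W) (Forget H (sval V) ⊗ U)),
          is_family phi ->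
          exists! phihat : mor (A (W, V)) U,
            phi = (idm (Forget H (sval V)) ⊗m phihat) ∘ h W V
      & forall (W W' : Comod H) (V V' : Comod_fd H) (g : mor W W') (f : mor V' V),
          (idm (Forget H (sval V)) ⊗m
             @fmap _ _ A (W, V) (W', V') (g, f)) ∘ h W V =
          (fmap (Forget H) f ⊗m idm (A (W', V'))) ∘ h W' V' ∘ fmap (Forget H) g])
  /\
  (exists (A : functor (Prod (Comod_fg H) (Op (Comod H))) (ProAlg_fg K))
          (h : forall (W : Comod_fg H) (V : Comod H),
             mor (pund H (sval W)) (pund H V ⊗p ProAlg_incl K (A (W, V)))),
    [/\ forall (W : Comod_fg H) (V : Comod H), is_profamily (h W V),
        forall (W : Comod_fg H) (V : Comod H) (U : ProAlg K)
          (phi : mor (pund H (sval W)) (pund H V ⊗p U)),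
          is_profamily phi ->
          exists! phihat : mor (ProAlg_incl K (A (W, V))) U,
            phi = (idm (pund H V) ⊗pm phihat) ∘ h W V
      & forall (W W' : Comod_fg H) (V V' : Comod H) (g : mor W W') (f : mor V' V),
          (idm (pund H V) ⊗pm
             fmap (ProAlg_incl K) (@fmap _ _ A (W, V) (W', V') (g, f))) ∘ h W V =
          (fmap (pund H) f ⊗pm idm (ProAlg_incl K (A (W', V')))) ∘ h W' V' ∘
            fmap (pund H) g]).
Proof.
split.
  have [A [h [h1 h2 h3]]] := @universal_functor
    (Comod H) (Comod_fd H) (Alg K) (Alg K)
    (Forget H) (functor_comp (Forget H) (Incl _)) (functor_id (Alg K)) (Tens K)
    (fun W V U phi => is_family (V := sval V) phi)
    (@functor_id_fully_faithful _)
    (fun W W' V V' U g f phi => @is_family_pull K H W W' (sval V) (sval V') U g f phi)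
    (fun W V => universal_family_fd W (svalP V)).
  by exists A, h; split.
apply: (@universal_functor (Comod_fg H) (Comod H) (ProAlg_fg K) (ProAlg K)
  (functor_comp (pund H) (Incl _)) (pund H) (ProAlg_incl K) (ProTens K)
  (fun W V U phi => is_profamily (W := sval W) phi)).
- exact: pro_incl_fully_faithful.
- by move=> W W' V V' U g f phi; apply: (@is_profamily_pull K H (sval W) (sval W')).
move=> W V; exists (univ_pro V (svalP W)), (univ_pro_map V (svalP W)).
split; first exact: univ_pro_family.
exact: univ_pro_universal.
Qed.
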